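(* Let $f,g:\mathbb{D}^n\to\mathbb{D}$ be given by $f(z)=z_1\cdots z_n$ and $g(z_1,\ldots,z_n)=\alpha_1z_1^n+\ldots+\alpha_nz_n^n$, where $\alpha_1,\ldots,\alpha_n$ are complex numbers with $\sum_j|\alpha_j|=1$ and $\alpha_j\ne 0$ for $j=1,\ldots,n$. Let $\beta>-1$. Then for any $\eta\in\mathbb{T}$, $$V_\beta(\{z\in\mathbb{D}^n:\ |f(z)-\eta|\le\delta\})\simeq\delta^{n(\beta+1)+1},$$ while $$V_\beta(\{z\in\mathbb{D}^n:\ |g(z)-\eta|\le\delta\})\simeq\delta^{n(\beta+1)+(n+1)/2},$$ for $\delta\in(0,1)$.
   Context: $\mathbb{D}$ is the open unit disc in $\mathbb{C}$, $\mathbb{T}=\partial\mathbb{D}$. $dA$ is the normalized area measure on $\mathbb{D}$; for $\beta>-1$, $dA_\beta(z)=(\beta+1)(1-|z|^2)^\beta dA(z)$, and $V_\beta$ is the measure $dV_\beta(z)=dA_\beta(z_1)\cdots dA_\beta(z_n)$ on $\mathbb{D}^n$. $F(\delta)\simeq G(\delta)$ means that $c\,G(\delta)\le F(\delta)\le C\,G(\delta)$ with positive constants $c,C$ independent of $\delta$. *)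

(* Defs.v *)
From HB Require Import structures.
From mathcomp Require Import all_boot all_order all_algebra.
From mathcomp Require Import complex.
From mathcomp Require Import all_classical all_reals all_analysis.

Set Implicit Arguments.
Unset Strict Implicit.
Unset Printing Implicit Defensive.

Import Order.TTheory GRing.Theory Num.Theory.
Import numFieldNormedType.Exports.

Local Open Scope classical_set_scope.
Local Open Scope complex_scope.
Local Open Scope ring_scope.

Section complex_measurable.
Context {R : realType}.

Definition complex_pair (z : R[i]) : measurableTypeR R * measurableTypeR R :=
  (complex.Re z, complex.Im z).

HB.instance Definition _ := isPointed.Build R[i] 0.

(* The Borel sigma-algebra of C, transported from R * R. *)
HB.instance Definition _ :=
  Measurable.copy R[i] (g_sigma_algebra_preimageType complex_pair).

End complex_measurable.

Section measures.
Variable R : realType.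
Implicit Types (b : R) (n : nat).

Definition disc : set R[i] := [set z | `|z| < 1].

Definition polydisc n : set (n.-tuple R[i]) :=
  [set z | forall j : 'I_n, disc (tnth z j)].

(* Two-dimensional Lebesgue measure on the disc, normalized to total mass 1. *)
Definition area (A : set R[i]) : \bar R :=
  ((pi^-1)%:E * (lebesgue_measure \x lebesgue_measure)%E
    [set p : measurableTypeR R * measurableTypeR R |
      (A `&` disc) (p.1 +i* p.2)])%E.

Definition weighted_area b (A : set R[i]) : \bar R :=
  (\int[area]_(z in A) ((b + 1) * (1 - complex.Re `|z| ^+ 2) `^ b)%:E)%E.

(* The n-fold product measure; the coordinates of a tuple are split off one by
   one, since the library only has binary products. *)
Fixpoint weighted_volume b n : set (n.-tuple R[i]) -> \bar R :=
  match n with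
  | 0 => \d_([tuple] : 0.-tuple R[i])
  | m.+1 => pushforward (weighted_area b \x weighted_volume b (n := m))%E
              (fun p : R[i] * m.-tuple R[i] => [tuple of p.1 :: p.2])
  end.

Definition coord_prod n (z : n.-tuple R[i]) : R[i] := \prod_(j < n) tnth z j.

Definition coord_powsum n (alpha : 'I_n -> R[i]) (z : n.-tuple R[i]) : R[i] :=
  \sum_(j < n) alpha j * tnth z j ^+ n.

Lemma coord_prod_disc n (z : n.-tuple R[i]) :
  (0 < n)%N -> polydisc z -> disc (coord_prod z).
Proof.
case: n z => // n z _ zD; rewrite /disc /coord_prod /= normr_prod.
have z1 j : `|tnth z j| < 1 by exact: zD.
have p1 : \prod_(j < n) `|tnth z (lift ord0 j)| <= 1.
  by apply: prodr_ile1 => j _; rewrite normr_ge0 ltW.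
rewrite big_ord_recl; apply: le_lt_trans (z1 ord0).
by rewrite ler_piMr.
Qed.

Lemma coord_powsum_disc n (alpha : 'I_n -> R[i]) (z : n.-tuple R[i]) :
  (0 < n)%N -> (forall j, alpha j != 0) -> \sum_(j < n) `|alpha j| = 1 ->
  polydisc z -> disc (coord_powsum alpha z).
Proof.
move=> n0 a0 a1 zD; rewrite /disc /coord_powsum /=.
apply: le_lt_trans (ler_norm_sum _ _ _) _; rewrite -a1.
apply: ltr_sum => [|j _].
  by apply/hasP; exists (Ordinal n0) => //; rewrite mem_index_enum.
rewrite normrM normrX gtr_pMr ?normr_gt0// exprn_ilt1 -?lt0n//.
exact: (zD j).
Qed.

Definition comparable01 (F : R -> \bar R) (G : R -> R) : Prop :=
  exists c C : R, [/\ 0 < c, 0 < C & forall delta : R, 0 < delta < 1 ->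
    ((c * G delta)%:E <= F delta <= (C * G delta)%:E)%E].

End measures.

(* Main.v *)
Require Import Defs.
From HB Require Import structures.
From mathcomp Require Import all_boot all_order all_algebra.
From mathcomp Require Import complex.
From mathcomp Require Import all_classical all_reals all_analysis.
From mathcomp Require Import measurable_realfun lra ring.

(** Both estimates reduce to a Carleson-box bound in one variable: the weighted
    area of [{z : |z - z0| <= rho, 0 < 1 - |z|^2 <= h}] is at most a constant
    times [rho * h^(beta+1)], with a matching lower bound when [|z0| = 1] and
    [h <= rho / 8].  The weight [(1 - |z|^2)^beta] is roughly constant on each
    dyadic shell [h/2 <= 1 - |z|^2 <= h], so only Lebesgue measure of shells
    matters, and this is read off from horizontal and vertical sections; the
    shells add up to a geometric series.

    If [|z_1 ... z_n - eta| <= delta] then [1 - |z_j| <= delta] for every [j],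
    and once all but one of the coordinates are fixed the last one lies in a disc
    of radius comparable to [delta].  If
    [|sum_j alpha_j z_j^n - eta| <= delta], projecting on [eta] shows that
    [alpha_j z_j^n] is within [O(sqrt delta)] of [|alpha_j| eta] and
    [1 - |z_j| = O(delta)]; again the last coordinate is confined to a disc of
    radius [O(delta)].  Hence each of the first [n - 1] coordinates contributes
    [delta^(beta+1)], respectively [delta^(beta+1+1/2)], and the last one
    [delta^(beta+2)]. *)

Set Implicit Arguments.
Unset Strict Implicit.
Unset Printing Implicit Defensive.

Import Order.TTheory GRing.Theory Num.Theory.
Import numFieldNormedType.Exports.

Local Open Scope classical_set_scope.
Local Open Scope complex_scope.
Local Open Scope ring_scope.

Local Notation nm := ComplexField.Normc.normc.
Local Notation normcM := ComplexField.Normc.normcM.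
Local Notation normcV := ComplexField.Normc.normcV.

(** * Real-valued moduli of complex numbers *)

Section normc_theory.
Variable R : realType.
Implicit Types z w : R[i].

Definition sqn z : R := complex.Re z ^+ 2 + complex.Im z ^+ 2.

Lemma normr_normc z : `|z| = (nm z)%:C.
Proof. by case: z. Qed.

Lemma sqr_normc_sqn z : nm z ^+ 2 = sqn z.
Proof. by case: z => x y; rewrite sqr_sqrtr// addr_ge0 ?sqr_ge0. Qed.

Lemma normc_ge0 z : 0 <= nm z.
Proof. by case: z => x y; exact: sqrtr_ge0. Qed.

Lemma normc_le z (r : R) : 0 <= r -> (nm z <= r) = (sqn z <= r ^+ 2).
Proof. by move=> r0; rewrite -sqr_normc_sqn ler_pXn2r// nnegrE// normc_ge0. Qed.

Lemma normcX z n : nm (z ^+ n) = nm z ^+ n.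
Proof.
elim: n => [|n IH]; first by rewrite !expr0 ComplexField.Normc.normc1.
by rewrite !exprS normcM IH.
Qed.

Lemma disc_normc z : disc z <-> nm z < 1.
Proof. by rewrite /disc/= normr_normc ltcR. Qed.

Lemma disc_sqn z : disc z <-> 0 < 1 - sqn z.
Proof.
by rewrite disc_normc subr_gt0 -sqr_normc_sqn expr_lt1// normc_ge0.
Qed.

Lemma normcD z w : nm (z + w) <= nm z + nm w.
Proof. by rewrite -lecR rmorphD/= -!normr_normc ler_normD. Qed.

Lemma normcN z : nm (- z) = nm z.
Proof. by apply: complexI; rewrite -!normr_normc normrN. Qed.

Lemma normcB z w : nm (z - w) = nm (w - z).
Proof. by rewrite -normcN opprB. Qed.

Lemma normc_eq0 z : (nm z == 0) = (z == 0).
Proof. by rewrite -(inj_eq (@complexI R)) -normr_normc normr_eq0. Qed.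

Lemma sqn_le_normc z (r : R) : 0 <= r -> 1 - r <= nm z -> 1 - sqn z <= 2 * r.
Proof.
move=> r0 zr; rewrite -sqr_normc_sqn; have := normc_ge0 z.
by have [r1|r1] := lerP r 1; nra.
Qed.

Lemma normc_ge_sqn z (r : R) : 0 <= r -> 1 - sqn z <= r -> 1 - r <= nm z.
Proof. by move=> r1; rewrite -sqr_normc_sqn; have := normc_ge0 z; nra. Qed.

End normc_theory.

(** * Measurability and the area measure *)

Section measurability.
Variable R : realType.

Lemma measurable_complex_pair :
  measurable_fun [set: R[i]] (@complex_pair R).
Proof. by move=> _ B mB; exists B. Qed.

Lemma measurable_Re : measurable_fun [set: R[i]] (@complex.Re R).
Proof.
exact: (measurableT_comp measurable_fst measurable_complex_pair).
Qed.

Lemma measurable_Im : measurable_fun [set: R[i]] (@complex.Im R).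
Proof.
exact: (measurableT_comp measurable_snd measurable_complex_pair).
Qed.

Lemma measurable_sqnB (a : R[i]) :
  measurable_fun [set: R[i]] (fun z => sqn (z - a)).
Proof.
have -> : (fun z => sqn (z - a)) = fun z : R[i] =>
    (complex.Re z - complex.Re a) ^+ 2 + (complex.Im z - complex.Im a) ^+ 2.
  by apply/funext => -[x y]; case: a.
by apply: measurable_funD; apply/measurable_funX/measurable_funB => //;
  [exact: measurable_Re|exact: measurable_Im].
Qed.

Lemma measurable_sqn : measurable_fun [set: R[i]] (@sqn R).
Proof.
by have := measurable_sqnB 0; under eq_fun do rewrite subr0.
Qed.

End measurability.

Section area_measure.
Variable R : realType.
Local Open Scope ereal_scope.
Let lam := @lebesgue_measure R.

Definition toC (p : measurableTypeR R * measurableTypeR R) : R[i] :=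
  (p.1 +i* p.2)%C.

Lemma measurable_toC : measurable_fun setT toC.
Proof.
move=> _ _ [B mB <-]; rewrite !setTI.
by rewrite (_ : _ @^-1` _ = B)//; apply/seteqP; split => -[].
Qed.

Lemma measurable_disc : measurable (@disc R).
Proof.
have -> : @disc R = (@sqn R) @^-1` `]-oo, 1%R[%classic.
  apply/seteqP; split => z; rewrite /= in_itv/=.
    by move=> /disc_sqn; rewrite subr_gt0.
  by move=> ?; apply/disc_sqn; rewrite subr_gt0.
by rewrite -[X in measurable X]setTI; apply: measurable_sqn.
Qed.

Lemma toC_disc : measurable (toC @^-1` @disc R).
Proof. by rewrite -[X in measurable X]setTI; exact: measurable_toC measurable_disc. Qed.

(** Lebesgue measure restricted to the disc, transported by [toC] and scaled by [pi^-1], supplies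
    the measure structure behind the bare set function [area]. *)
Lemma area_measureP : exists m : {measure set R[i] -> \bar R}, area (R := R) = m.
Proof.
have p0 : (0 <= (pi : R)^-1)%R by rewrite invr_ge0 pi_ge0.
unshelve refine (ex_intro _ (mscale (NngNum p0)
  (pushforward (mrestr (lam \x lam) toC_disc) toC)
  : {measure set R[i] -> \bar R}) _); first exact: measurable_toC.
by apply/funext => A; rewrite /area /mscale/= /pushforward /mrestr.
Qed.

Lemma measurable_weight (b : R) : measurable_fun [set: R[i]]
  (fun z : R[i] => ((b + 1) * (1 - complex.Re `|z| ^+ 2) `^ b)%:E).
Proof.
apply/measurable_EFinP/measurable_funM => //.
apply: (measurableT_comp (f := fun x : R => (x `^ b)%R)); first exact: measurable_powR.
have -> : (fun z : R[i] => 1 - complex.Re `|z| ^+ 2)%R =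
    fun z => (1 - sqn z)%R.
  by apply/funext => z; rewrite -sqr_normc_sqn normr_normc.
by apply: measurable_funB => //; exact: measurable_sqn.
Qed.

Lemma weight_ge0 (b : R) (z : R[i]) : (-1 < b)%R ->
  (0 <= (b + 1) * (1 - complex.Re `|z| ^+ 2) `^ b)%R.
Proof. by move=> b1; rewrite mulr_ge0 ?powR_ge0//; lra. Qed.

(** As [-1 < b] makes the density nonnegative, its indefinite integral is countably additive. Later
    proofs rewrite [weighted_area b] into this measure to use additivity and integration. *)
Lemma weighted_area_measureP (b : R) : (-1 < b)%R ->
  exists m : {measure set R[i] -> \bar R}, weighted_area b = m.
Proof.
move=> b1; rewrite /weighted_area; have [a ->] := area_measureP.
set f := (X in fun A => \int[a]_(z in A) X z).
have f0 z : 0 <= f z by rewrite lee_fin weight_ge0.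
have m0 : (fun A => \int[a]_(z in A) f z) set0 = 0 by rewrite integral_set0.
have m1 A : 0 <= \int[a]_(z in A) f z by exact: integral_ge0.
have m2 : semi_sigma_additive (fun A => \int[a]_(z in A) f z).
  by apply: semi_sigma_additive_nng_induced => //; exact: measurable_weight.
pose mm := isMeasure.Build _ _ _ (fun A => \int[a]_(z in A) f z) m0 m1 m2.
pose m : {measure set _ -> \bar R} := HB.pack (fun A => \int[a]_(z in A) f z) mm.
by exists m.
Qed.

End area_measure.

(** * Comparing integrals with constants *)

Section integral_bounds.
Local Open Scope ereal_scope.
Context d (T : measurableType d) (R : realType).
Variable mu : {measure set T -> \bar R}.
Implicit Types (f g : T -> \bar R) (D A : set T).

(* Unlike [ge0_le_integral], no measurability is required. *)
Lemma ge0_le_integral_restrict D A f g :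
  (forall x, D x -> 0 <= f x) -> (forall x, A x -> 0 <= g x) ->
  (forall x, (f \_ D) x <= (g \_ A) x) ->
  \int[mu]_(x in D) f x <= \int[mu]_(x in A) g x.
Proof.
move=> f0 g0 fg; rewrite !ge0_integralE//.
apply: ge_ereal_sup => _ [h /= hf <-]; apply: ereal_sup_ubound.
by exists h => // x; apply: le_trans (hf x) (fg x).
Qed.

(** Meant for integrands such as the volume of a section as a function of the first coordinate,
    whose measurability is never established; only the confining set [A] has to be measurable. *)
Lemma integral_le_cst D A f (C : R) : measurable A -> (0 <= C)%R ->
  (forall x, D x -> 0 <= f x) -> (forall x, D x -> f x <= C%:E) ->
  (forall x, D x -> ~ A x -> f x = 0) ->
  \int[mu]_(x in D) f x <= C%:E * mu A.
Proof.
move=> mA C0 f0 fC fA; rewrite -integral_cst//.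
apply: ge0_le_integral_restrict => // x.
rewrite !patchE; case: ifPn => [|_].
  rewrite inE => Dx; case: ifPn => [_|]; first exact: fC.
  by rewrite notin_setE => /(fA _ Dx) ->.
by case: ifPn => // _; rewrite lee_fin.
Qed.

Lemma integral_ge_cst D A f (c : R) : measurable A -> (0 <= c)%R ->
  A `<=` D -> (forall x, D x -> 0 <= f x) -> (forall x, A x -> c%:E <= f x) ->
  c%:E * mu A <= \int[mu]_(x in D) f x.
Proof.
move=> mA c0 AD f0 fc; rewrite -integral_cst//.
apply: ge0_le_integral_restrict => // x.
rewrite !patchE; case: ifPn => [|_].
  by rewrite inE => Ax; rewrite mem_set; [exact: fc|exact: AD].
by case: ifPn => //; rewrite inE => /f0.
Qed.

End integral_bounds.

Section lebesgue.
Variable R : realType.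
Local Open Scope ereal_scope.

(** Around any of its points [x], the set lies in the interval from [x - h] to [x + h]. *)
Lemma lebesgue_measure_oscillation (A : set R) (h : R) : measurable A ->
  (0 <= h)%R -> (forall x y, A x -> A y -> (`|x - y| <= h)%R) ->
  lebesgue_measure A <= (2 * h)%:E.
Proof.
move=> mA h0 Ah; have [->|/set0P[x Ax]] := eqVneq A set0.
  by rewrite measure0 lee_fin mulr_ge0.
apply: (@le_trans _ _ (lebesgue_measure `[(x - h)%R, (x + h)%R]%classic)).
  apply: le_measure; rewrite ?inE// => y Ay /=.
  by rewrite in_itv/= -ler_distl Ah.
rewrite lebesgue_measure_itv/= lte_fin; case: ifPn => _.
  by rewrite -EFinB lee_fin; lra.
by rewrite lee_fin mulr_ge0.
Qed.

Lemma lebesgue_measure_itvcc (a b : R) : (a <= b)%R ->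
  lebesgue_measure `[a, b]%classic = (b - a)%:E.
Proof.
rewrite lebesgue_measure_itv/= lte_fin le_eqVlt => /predU1P[->|->].
  by rewrite ltxx subrr.
by rewrite -EFinB.
Qed.

End lebesgue.

Lemma measurable_ler d (T : measurableType d) (R : realType) (f g : T -> R) :
  measurable_fun setT f -> measurable_fun setT g ->
  measurable [set x | f x <= g x].
Proof.
move=> mf mg; have := measurable_fun_ler mf mg => /(_ measurableT [set true]).
by rewrite setTI; apply.
Qed.

Lemma measurable_ltr d (T : measurableType d) (R : realType) (f g : T -> R) :
  measurable_fun setT f -> measurable_fun setT g ->
  measurable [set x | f x < g x].
Proof.
move=> mf mg; have := measurable_fun_ltr mf mg => /(_ measurableT [set true]).
by rewrite setTI; apply.
Qed.

(** * Area of pieces of annuli *)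

Section sections.
Variable R : realType.
Implicit Types a b x y h rho : R.

(** If [h < 1/2], the shell condition and [x ^+ 2 <= y ^+ 2] force [y >= 1/2], and likewise for
    [y']. The squares differ by at most [h], and dividing by [y + y' >= 1] gives the bound. For
    larger [h] it suffices that both points lie between 0 and 1. *)
Lemma annulus_section_oscillation x y y' h :
  0 <= y -> 0 <= y' -> x ^+ 2 <= y ^+ 2 -> x ^+ 2 <= y' ^+ 2 ->
  0 < 1 - (x ^+ 2 + y ^+ 2) <= h -> 0 < 1 - (x ^+ 2 + y' ^+ 2) <= h ->
  `|y - y'| <= 2 * h.
Proof.
move=> y0 y'0 xy xy' /andP[h1 h2] /andP[h3 h4].
rewrite ler_norml.
have x0 := sqr_ge0 x.
have [hh|hh] := lerP (2^-1) h.
  have : y <= 1 by nra.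
  have : y' <= 1 by nra.
  by lra.
have : 2^-1 <= y by nra.
have : 2^-1 <= y' by nra.
by move=> ? ?; apply/andP; split; nra.
Qed.

Lemma measurable_annulus_section x h (P : set R) : measurable P ->
  measurable ([set y : measurableTypeR R | 0 < 1 - (x ^+ 2 + y ^+ 2) <= h /\
     x ^+ 2 <= y ^+ 2] `&` P).
Proof.
move=> mP; apply: measurableI => //.
have mX : measurable_fun setT (fun y : measurableTypeR R => 1 - (x ^+ 2 + y ^+ 2)).
  by apply: measurable_funB => //; apply: measurable_funD => //; apply: measurable_funX.
have -> : [set y : measurableTypeR R | 0 < 1 - (x ^+ 2 + y ^+ 2) <= h /\
     x ^+ 2 <= y ^+ 2] =
   [set y | 0 < 1 - (x ^+ 2 + y ^+ 2)] `&` [set y | 1 - (x ^+ 2 + y ^+ 2) <= h]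
   `&` [set y : measurableTypeR R | x ^+ 2 <= y ^+ 2].
  by apply/seteqP; split => y /= [] => [/andP[]|[]] => [? ? ?|-> ->].
apply: measurableI; last by apply: measurable_ler => //; apply: measurable_funX.
by apply: measurableI; [apply: measurable_ltr|apply: measurable_ler].
Qed.

(** The parts with [y >= 0] and [y <= 0] each oscillate by at most [2 * h], so each has measure at
    most [4 * h]. *)
Lemma lebesgue_annulus_section x h : 0 <= h ->
  (lebesgue_measure [set y : measurableTypeR R |
    (0 < 1 - (x ^+ 2 + y ^+ 2) <= h)%R /\ (x ^+ 2 <= y ^+ 2)%R] <= (8 * h)%:E)%E.
Proof.
move=> h0; set A := [set y | _].
have mA := @measurable_annulus_section x h.
have h20 : 0 <= 2 * h by rewrite mulr_ge0.
have -> : A = (A `&` `[0, +oo[%classic) `|` (A `&` `]-oo, 0]%classic).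
  rewrite -setIUr; apply/seteqP; split => y /=; last by case.
  move=> Ay; split => //; rewrite !in_itv/= andbT.
  by apply/orP; rewrite le_total.
apply: le_trans (measureU2 _ (mA _ _) (mA _ _)) _; rewrite //.
rewrite (_ : 8 * h = 2 * (2 * h) + 2 * (2 * h)); last by ring.
rewrite EFinD; apply: leeD; apply: lebesgue_measure_oscillation => //; try exact: mA.
  move=> y y' [[/= ? ?]] + [[/= ? ?]]; rewrite !in_itv/= !andbT => ? ?.
  exact: (@annulus_section_oscillation x).
move=> y y' [[/= ? ?]] + [[/= ? ?]]; rewrite !in_itv/= => ? ?.
have -> : `|y - y'| = `|- y - - y'| by rewrite -normrN; congr `|_|; ring.
by apply: (@annulus_section_oscillation x); rewrite ?sqrrN ?oppr_ge0.
Qed.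

(** The hypotheses give [b >= 7/10]. Both [x ^+ 2 - a ^+ 2] and [h] are of order [rho], hence so is
    [y ^+ 2 - b ^+ 2]; dividing by [y + b] yields [|y - b| <= 3 * rho / 4], and the squares of 1/8
    and 3/4 add up to less than 1. *)
Lemma circle_box_le a b x y rho h :
  a ^+ 2 + b ^+ 2 = 1 -> a ^+ 2 <= b ^+ 2 -> 0 <= b -> 0 <= y ->
  `|x - a| <= rho / 8 -> rho <= 1 -> 0 < h -> h <= rho / 8 ->
  1 - x ^+ 2 - h <= y ^+ 2 -> y ^+ 2 <= 1 - x ^+ 2 ->
  (x - a) ^+ 2 + (y - b) ^+ 2 <= rho ^+ 2.
Proof.
move=> ab1 ab b0 y0; rewrite ler_norml => /andP[xa1 xa2] r1 h0 hr y1 y2.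
have b7 : 7 / 10 <= b by nra.
have a1 : a <= 3 / 4 by nra.
have a2 : - (3 / 4) <= a by nra.
have d1 : y ^+ 2 - b ^+ 2 <= rho * 2 / 8 by nra.
have d2 : - (rho * 3 / 8) <= y ^+ 2 - b ^+ 2 by nra.
have e1 : (y - b) <= rho * 3 / 4 by nra.
have e2 : - (rho * 3 / 4) <= y - b by nra.
have : (y - b) ^+ 2 <= (rho * 3 / 4) ^+ 2 by nra.
have : (x - a) ^+ 2 <= (rho / 8) ^+ 2 by nra.
by nra.
Qed.

Lemma lebesgue_annulus_section_ge a b x rho h (B : set (measurableTypeR R)) :
  a ^+ 2 + b ^+ 2 = 1 -> a ^+ 2 <= b ^+ 2 ->
  `|x - a| <= rho / 8 -> rho <= 1 -> 0 < h -> h <= rho / 8 -> measurable B ->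
  (forall y : R, (x - a) ^+ 2 + (y - b) ^+ 2 <= rho ^+ 2 ->
    h / 2 <= 1 - (x ^+ 2 + y ^+ 2) <= h -> B y) ->
  ((h / 4)%:E <= lebesgue_measure B)%E.
Proof.
move=> ab1 ab xa r1 h0 hr mB AB.
have x2 : x ^+ 2 <= 7 / 10.
  move: (xa); rewrite ler_norml => /andP[xa1 xa2].
  have a1 : a <= 71 / 100 by nra.
  have a2 : - (71 / 100) <= a by nra.
  by nra.
have s0 : 0 <= 1 - x ^+ 2 - h by lra.
have t0 : 0 <= 1 - x ^+ 2 - h / 2 by lra.
(* Between [s] and [t] lie exactly the [y >= 0] in the shell over [x]. Since
   [t ^+ 2 - s ^+ 2 = h / 2] and [t + s <= 2], this interval has length at least [h / 4]. *)
pose s := Num.sqrt (1 - x ^+ 2 - h); pose t := Num.sqrt (1 - x ^+ 2 - h / 2).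
have s20 : 0 <= s by exact: sqrtr_ge0.
have t20 : 0 <= t by exact: sqrtr_ge0.
have s2 : s ^+ 2 = 1 - x ^+ 2 - h by rewrite sqr_sqrtr.
have t2 : t ^+ 2 = 1 - x ^+ 2 - h / 2 by rewrite sqr_sqrtr.
have xx := sqr_ge0 x.
have s1 : s <= 1 by nra.
have t1 : t <= 1 by nra.
have ts : 0 < t + s by rewrite ltr_wpDr// sqrtr_gt0; lra.
have st : h / 4 <= t - s.
  by rewrite -(ler_pM2r ts); nra.
have boxP (y c : R) : c ^+ 2 = b ^+ 2 -> 0 <= c -> s <= y -> y <= t ->
    (x - a) ^+ 2 + (y - c) ^+ 2 <= rho ^+ 2 /\ h / 2 <= 1 - (x ^+ 2 + y ^+ 2) <= h.
  move=> cb c0 ys yt.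
  have y1 : s ^+ 2 <= y ^+ 2 by nra.
  have y2 : y ^+ 2 <= t ^+ 2 by nra.
  split; last by lra.
  by apply: (circle_box_le (h := h)) => //; rewrite ?cb//; lra.
have [b0|b0] := leP 0 b.
  apply: (@le_trans _ _ (lebesgue_measure `[s, t]%classic)).
    by rewrite lebesgue_measure_itvcc ?lee_fin//; lra.
  apply: le_measure; rewrite ?inE// => y /=; rewrite in_itv/= => /andP[].
  move=> sy yt; have [] := boxP _ _ (erefl _) b0 sy yt; exact: AB.
have boxN (y : R) : - t <= y -> y <= - s ->
    (x - a) ^+ 2 + (y - b) ^+ 2 <= rho ^+ 2 /\ h / 2 <= 1 - (x ^+ 2 + y ^+ 2) <= h.
  move=> ty ys; have [] := boxP (- y) (- b); rewrite ?sqrrN//; [lra..|].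
  by have -> : (- y - - b) ^+ 2 = (y - b) ^+ 2 by ring.
apply: (@le_trans _ _ (lebesgue_measure `[- t, - s]%classic)).
  by rewrite lebesgue_measure_itvcc ?lee_fin//; lra.
apply: le_measure; rewrite ?inE// => y /=; rewrite in_itv/= => /andP[].
move=> ty ys; have [] := boxN _ ty ys; exact: AB.
Qed.

End sections.

Section plane.
Variable R : realType.
Implicit Types (a b rho h : R).
Let T := measurableTypeR R.
Let lam : set T -> \bar R := @lebesgue_measure R.
Let lam2 : set (T * T) -> \bar R := (lam \x lam)%E.

Lemma lebesgue_product_swap (A : set (T * T)) : measurable A ->
  lam2 A = (lam \x^ lam)%E A.
Proof.
by move=> mA; apply: product_measure_unique => // X Y mX mY; exact: product_measure2E.
Qed.

(** Where [|y| < |x|], vertical sections of the shell can be much larger than [h]. The set is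
    therefore cut along [|x| = |y|], with vertical sections on one piece and horizontal ones on the
    other: measure at most [8 * h] over an interval of length [2 * rho] each time. *)
Lemma lebesgue_product_annulus_le (P : set (T * T)) a b rho h :
  measurable P -> 0 <= rho -> 0 <= h ->
  (forall x y : R, P (x, y) -> [/\ `|x - a| <= rho, `|y - b| <= rho &
    0 < 1 - (x ^+ 2 + y ^+ 2) <= h]) ->
  (lam2 P <= (32 * rho * h)%:E)%E.
Proof.
move=> mP rho0 h0 Pab.
have half (Q : set (T * T)) (c : R) : measurable Q ->
    (forall x y : R, Q (x, y) -> [/\ `|x - c| <= rho,
      0 < 1 - (x ^+ 2 + y ^+ 2) <= h & x ^+ 2 <= y ^+ 2]) ->
    (lam2 Q <= (16 * rho * h)%:E)%E.
  move=> mQ Qc; rewrite /lam2 /product_measure1.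
  have -> : (16 * rho * h)%:E =
      ((8 * h)%:E * lam `[(c - rho)%R, (c + rho)%R]%classic)%E.
    by rewrite /lam lebesgue_measure_itvcc -?EFinM ?lerD2l; [congr EFin; ring|lra].
  apply: integral_le_cst => //.
  - by rewrite mulr_ge0.
  - move=> x _; apply: le_trans (lebesgue_annulus_section x h0).
    apply: le_measure; rewrite ?inE.
    + exact: measurable_xsection.
    + by have := @measurable_annulus_section _ x h setT measurableT; rewrite setIT.
    + by move=> y; rewrite /xsection/= inE => /Qc[].
  - move=> x _ xc; rewrite /= (_ : xsection Q x = set0) ?measure0//.
    rewrite -subset0 => y; rewrite /xsection/= inE => /Qc[+ _ _].
    by rewrite ler_distl => ?; apply: xc; rewrite /= in_itv.
have m1 : measurable_fun setT (fun p : T * T => (p.1 : R) ^+ 2).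
  exact: measurable_funX.
have m2 : measurable_fun setT (fun p : T * T => (p.2 : R) ^+ 2).
  exact: measurable_funX.
pose P1 := P `&` [set p : T * T | (p.1 : R) ^+ 2 <= (p.2 : R) ^+ 2].
pose P2 := P `&` [set p : T * T | (p.2 : R) ^+ 2 <= (p.1 : R) ^+ 2].
have mP1 : measurable P1 by apply: measurableI => //; exact: measurable_ler.
have mP2 : measurable P2 by apply: measurableI => //; exact: measurable_ler.
have -> : P = P1 `|` P2.
  rewrite -setIUr; apply/seteqP; split => p; last by case.
  by move=> Pp; split => //=; apply/orP; exact: le_total.
apply: le_trans (measureU2 _ mP1 mP2) _.
rewrite (_ : 32 * rho * h = 16 * rho * h + 16 * rho * h); last by ring.
rewrite EFinD; apply: leeD.
  by apply: (half _ a) => // x y [/Pab[? ? ?] ?].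
rewrite /= -/lam2 lebesgue_product_swap//.
have -> : (lam \x^ lam)%E P2 = lam2 ((fun p : T * T => (p.2, p.1)) @^-1` P2).
  by [].
apply: (half _ b) => //.
  by rewrite -[X in measurable X]setTI; exact: measurable_swap.
by move=> x y [/Pab[? ? ?] ?]; split => //; rewrite (addrC (x ^+ 2)).
Qed.

(** After exchanging the coordinates if necessary, the centre satisfies [a ^+ 2 <= b ^+ 2]; then an
    interval of length [rho / 4] carries sections of measure at least [h / 4]. *)
Lemma lebesgue_product_annulus_ge (P : set (T * T)) a b rho h :
  measurable P -> a ^+ 2 + b ^+ 2 = 1 -> rho <= 1 -> 0 < h -> h <= rho / 8 ->
  (forall x y : R, (x - a) ^+ 2 + (y - b) ^+ 2 <= rho ^+ 2 ->
    h / 2 <= 1 - (x ^+ 2 + y ^+ 2) <= h -> P (x, y)) ->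
  ((rho * h / 16)%:E <= lam2 P)%E.
Proof.
move=> mP ab1 rho1 h0 hr Pab.
have half (Q : set (T * T)) (c d : R) : measurable Q ->
    c ^+ 2 + d ^+ 2 = 1 -> c ^+ 2 <= d ^+ 2 ->
    (forall x y : R, (x - c) ^+ 2 + (y - d) ^+ 2 <= rho ^+ 2 ->
    h / 2 <= 1 - (x ^+ 2 + y ^+ 2) <= h -> Q (x, y)) ->
    ((rho * h / 16)%:E <= lam2 Q)%E.
  move=> mQ cd1 cd Qc; rewrite /lam2 /product_measure1.
  have -> : (rho * h / 16)%:E =
      ((h / 4)%:E * lam `[(c - rho / 8)%R, (c + rho / 8)%R]%classic)%E.
    by rewrite /lam lebesgue_measure_itvcc -?EFinM ?lerD2l; [congr EFin; field|lra].
  apply: integral_ge_cst => //; first lra.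
  move=> x /=; rewrite in_itv/= -ler_distl => xc.
  apply: (lebesgue_annulus_section_ge cd1 cd xc rho1 h0 hr).
    exact: measurable_xsection.
  by move=> y ? ?; rewrite /xsection/= inE; exact: Qc.
have [ab|ba] := lerP (a ^+ 2) (b ^+ 2); first exact: (half _ a b).
rewrite lebesgue_product_swap//.
have -> : (lam \x^ lam)%E P = lam2 ((fun p : T * T => (p.2, p.1)) @^-1` P).
  by [].
apply: (half _ b a) => //.
- by rewrite -[X in measurable X]setTI; exact: measurable_swap.
- by rewrite addrC.
- exact: ltW.
- by move=> x y; rewrite addrC (addrC (x ^+ 2)) => ? ?; exact: Pab.
Qed.

End plane.

(** * Weighted area of Carleson boxes *)

Section area_bounds.
Variable R : realType.
Implicit Types (z : R[i]) (A : set R[i]) (rho h : R).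

Lemma sqr_ler_norm (x y rho : R) : 0 <= rho -> x ^+ 2 + y ^+ 2 <= rho ^+ 2 ->
  `|x| <= rho.
Proof.
move=> r0 xy; rewrite -(@ler_pXn2r _ 2) ?nnegrE// real_normK ?num_real//.
by apply: le_trans xy; rewrite lerDl sqr_ge0.
Qed.

Lemma area_annulus_le A z0 rho h : measurable A -> 0 <= rho -> 0 <= h ->
  (forall z, A z -> sqn (z - z0) <= rho ^+ 2 /\ 0 < 1 - sqn z <= h) ->
  (area A <= (32 / pi * rho * h)%:E)%E.
Proof.
move=> mA r0 h0 Az; rewrite /area.
have -> : 32 / pi * rho * h = pi^-1 * (32 * rho * h) by ring.
rewrite [leRHS]EFinM; apply: lee_wpmul2l; first by rewrite lee_fin invr_ge0 pi_ge0.
case: z0 Az => a b Az.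
apply: (@lebesgue_product_annulus_le _ _ a b) => //.
  have -> : [set p | (A `&` @disc R) (p.1 +i* p.2)] = @toC R @^-1` (A `&` @disc R).
    by [].
  rewrite -[X in measurable X]setTI; apply: (measurable_toC measurableT).
  by apply: measurableI => //; exact: measurable_disc.
move=> x y [/= /Az[H1 H2] _]; split => //; first exact: sqr_ler_norm H1.
by apply: (@sqr_ler_norm _ (x - a)) => //; rewrite addrC.
Qed.

Lemma area_annulus_ge A u rho h : measurable A -> sqn u = 1 -> rho <= 1 ->
  0 < h -> h <= rho / 8 ->
  (forall z, sqn (z - u) <= rho ^+ 2 -> h / 2 <= 1 - sqn z <= h -> A z) ->
  ((pi^-1 * (rho * h / 16))%:E <= area A)%E.
Proof.
move=> mA u1 r1 h0 hr Az; rewrite /area.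
rewrite [leLHS]EFinM; apply: lee_wpmul2l; first by rewrite lee_fin invr_ge0 pi_ge0.
case: u u1 Az => a b u1 Az.
apply: (@lebesgue_product_annulus_ge _ _ a b) => //.
  have -> : [set p | (A `&` @disc R) (p.1 +i* p.2)] = @toC R @^-1` (A `&` @disc R).
    by [].
  rewrite -[X in measurable X]setTI; apply: (measurable_toC measurableT).
  by apply: measurableI => //; exact: measurable_disc.
move=> x y H1 H2; split => /=; first exact: Az.
by apply/disc_sqn; case/andP: H2 => + _; apply: lt_le_trans; lra.
Qed.

(** Monotonicity of the power settles [0 <= b]; for negative [b] the same bounds with exponent [- b]
    are inverted. *)
Lemma powR_dyadic (b : R) : exists c C : R, [/\ 0 < c, 0 < C &
  forall h s, 0 < h -> h / 2 <= s <= h -> c * h `^ b <= s `^ b <= C * h `^ b].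
Proof.
have h20 : 0 < (2^-1 : R) `^ b by rewrite powR_gt0.
have powq (p h s : R) : 0 <= p -> 0 < h -> h / 2 <= s <= h ->
    2^-1 `^ p * h `^ p <= s `^ p <= h `^ p.
  move=> p0 hh /andP[sh1 sh2]; rewrite -powRM//; last exact: ltW.
  by rewrite !ge0_ler_powR// ?nnegrE ?mulr_ge0 ?(ltW hh)//; lra.
have [b0|b0] := lerP 0 b.
  exists (2^-1 `^ b), 1; split => // h s hh sh; rewrite mul1r; exact: powq.
exists 1, (2^-1 `^ b); split => // h s hh sh; rewrite mul1r.
have s0 : 0 < s by case/andP: sh => + _; lra.
have /powq : 0 <= - b by lra.
move=> /(_ h s hh sh); rewrite !powRN -invfM => /andP[].
by rewrite !lef_pV2 ?posrE ?mulr_gt0 ?powR_gt0// => -> ->.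
Qed.

End area_bounds.

Section weighted_area_bounds.
Variables (R : realType) (b : R).
Hypothesis b1 : -1 < b.
Implicit Types (z : R[i]) (A : set R[i]) (rho h : R).

Definition annulus_box z0 rho lo h : set R[i] :=
  [set z | sqn (z - z0) <= rho ^+ 2 /\ lo <= 1 - sqn z <= h].

Lemma measurable_annulus_box z0 rho lo h : measurable (annulus_box z0 rho lo h).
Proof.
have ms := @measurable_sqn R.
have m1 : measurable_fun setT (fun z : R[i] => 1 - sqn z) by exact: measurable_funB.
have -> : annulus_box z0 rho lo h = [set z | sqn (z - z0) <= rho ^+ 2] `&`
    [set z | lo <= 1 - sqn z] `&` [set z | 1 - sqn z <= h].
  apply/seteqP; split => p; first by case=> ? /andP[].
  by case=> -[? h1 h2]; split => //; apply/andP.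
apply: measurableI; last exact: measurable_ler.
apply: measurableI; last exact: measurable_ler.
by apply: measurable_ler => //; exact: measurable_sqnB.
Qed.

Lemma le_weighted_area A B : A `<=` B -> (weighted_area b A <= weighted_area b B)%E.
Proof.
rewrite /weighted_area; have [a ->] := area_measureP R => AB.
have w0 z : (0 <= ((b + 1) * (1 - complex.Re `|z| ^+ 2) `^ b)%:E)%E.
  by rewrite lee_fin weight_ge0.
apply: ge0_le_integral_restrict => // z; rewrite !patchE.
case: ifPn => [|_]; first by rewrite inE => /AB /mem_set ->.
by case: ifPn.
Qed.

Lemma Re_normr z : complex.Re `|z| ^+ 2 = sqn z.
Proof. by rewrite -sqr_normc_sqn normr_normc. Qed.

Lemma weighted_area_dyadic_le : exists2 C, 0 <= C &
  forall z0 rho h, 0 <= rho -> 0 < h ->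
  (weighted_area b (annulus_box z0 rho (h / 2)%R h) <= (C * rho * h `^ (b + 1))%:E)%E.
Proof.
have b10 : 0 < b + 1 by rewrite -ltrBlDr sub0r.
have b11 := ltW b10.
have [c [C [c0 C0 cC]]] := powR_dyadic b.
exists ((b + 1) * C * (32 / pi)).
  by rewrite !mulr_ge0 ?invr_ge0 ?pi_ge0 ?(ltW C0).
move=> z0 rho h r0 h0.
rewrite (_ : _ * h `^ (b + 1) =
    (b + 1) * (C * h `^ b) * (32 / pi * rho * h)); last first.
  by rewrite powRD ?powRr1 ?(ltW h0) ?gt_eqF ?implybT//; ring.
have m := measurable_annulus_box z0 rho (h / 2) h.
have := @area_annulus_le _ _ z0 rho h m r0 (ltW h0).
have C1 : 0 <= (b + 1) * (C * h `^ b).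
  by rewrite !mulr_ge0 ?powR_ge0 ?(ltW C0).
rewrite /weighted_area; have [a ->] := area_measureP R => ale.
rewrite [leRHS]EFinM; apply: (@le_trans _ _ (((b + 1) * (C * h `^ b))%:E *
    a (annulus_box z0 rho (h / 2)%R h))%E).
  apply: integral_le_cst => // z; first by rewrite lee_fin weight_ge0.
  case=> _ zh; rewrite lee_fin Re_normr ler_wpM2l//.
  by have /andP[] := cC _ _ h0 zh.
apply: lee_wpmul2l; rewrite ?lee_fin//; apply: ale => z [? /andP[h1 h2]]; split => //.
by rewrite h2 andbT; lra.
Qed.

(** The outermost dyadic shell alone already carries the full order [rho * h^(b+1)], so lower bounds
    involve no summation. *)
Lemma weighted_area_ge : exists2 c, 0 < c &
  forall u rho h, sqn u = 1 -> rho <= 1 -> 0 < h -> h <= rho / 8 ->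
  ((c * rho * h `^ (b + 1))%:E <= weighted_area b (annulus_box u rho (h / 2)%R h))%E.
Proof.
have b10 : 0 < b + 1 by rewrite -ltrBlDr sub0r.
have b11 := ltW b10.
have [c [C [c0 C0 cC]]] := powR_dyadic b.
have p0 : 0 < (pi : R)^-1 by rewrite invr_gt0 pi_gt0.
exists ((b + 1) * c * (pi^-1 / 16)).
  by rewrite !mulr_gt0.
move=> u rho h u1 r1 h0 hr.
rewrite (_ : _ * h `^ (b + 1) =
    (b + 1) * (c * h `^ b) * (pi^-1 * (rho * h / 16))); last first.
  by rewrite powRD ?powRr1 ?(ltW h0) ?gt_eqF ?implybT//; ring.
have m := measurable_annulus_box u rho (h / 2) h.
have := @area_annulus_ge _ _ u rho h m u1 r1 h0 hr.
have C1 : 0 <= (b + 1) * (c * h `^ b).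
  by rewrite !mulr_ge0 ?powR_ge0 ?(ltW c0).
rewrite /weighted_area; have [a ->] := area_measureP R => ale.
rewrite [leLHS]EFinM; apply: (@le_trans _ _ (((b + 1) * (c * h `^ b))%:E *
    a (annulus_box u rho (h / 2)%R h))%E).
  by apply: lee_wpmul2l; rewrite ?lee_fin//; apply: ale.
apply: integral_ge_cst => // z; first by rewrite lee_fin weight_ge0.
case=> _ zh; rewrite lee_fin Re_normr ler_wpM2l//.
by have /andP[] := cC _ _ h0 zh.
Qed.

End weighted_area_bounds.

Section carleson.
Variables (R : realType) (b : R).
Hypothesis b1 : -1 < b.
Implicit Types (z : R[i]) (A : set R[i]) (rho h : R).

Definition carleson_box z0 rho h : set R[i] :=
  [set z | sqn (z - z0) <= rho ^+ 2 /\ 0 < 1 - sqn z <= h].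

Lemma measurable_carleson_box z0 rho h : measurable (carleson_box z0 rho h).
Proof.
have ms := @measurable_sqn R.
have m1 : measurable_fun setT (fun z : R[i] => 1 - sqn z) by exact: measurable_funB.
have -> : carleson_box z0 rho h = [set z | sqn (z - z0) <= rho ^+ 2] `&`
    [set z | 0 < 1 - sqn z] `&` [set z | 1 - sqn z <= h].
  apply/seteqP; split => p; first by case=> ? /andP[].
  by case=> -[? h1 h2]; split => //; apply/andP.
apply: measurableI; last exact: measurable_ler.
apply: measurableI; last exact: measurable_ltr.
by apply: measurable_ler => //; exact: measurable_sqnB.
Qed.

Lemma carleson_box_dyadic z0 rho h : carleson_box z0 rho h `<=`
  \bigcup_k annulus_box z0 rho (h / 2 ^+ k / 2) (h / 2 ^+ k).
Proof.
move=> z [zr /andP[z0' zh]].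
set s := 1 - sqn z in z0' zh.
have h0 : 0 < h by exact: lt_le_trans zh.
have ex : exists k, h / 2 ^+ k / 2 <= s.
  have [k hk] : exists k : nat, h / s <= k%:R.
    by exists (Num.truncn (h / s)).+1; rewrite ltW// truncnS_gt.
  exists k; rewrite -mulrA -invfM -exprSr ler_pdivrMr ?exprn_gt0// mulrC.
  rewrite -ler_pdivrMr//; apply: le_trans hk _.
  by rewrite -natrX ler_nat ltnW// ltnW// ltn_expl.
(* For the least such [k], failure at [k - 1] says [s < h / 2^k]; for [k = 0] the upper bound is the
   hypothesis [s <= h]. *)
have hk := ex_minnP ex; case: hk => k hk kmin; exists k => //; split => //.
rewrite -/s hk/=; case: k hk kmin => [|k] hk kmin; first by rewrite expr0 divr1.
rewrite leNgt; apply/negP => hs.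
have /kmin : h / 2 ^+ k / 2 <= s.
  by rewrite -mulrA -invfM -exprSr ltW.
by rewrite ltnn.
Qed.

Lemma weighted_area_carleson_le : exists2 C, 0 <= C &
  forall z0 rho h, 0 <= rho -> 0 < h ->
  (weighted_area b (carleson_box z0 rho h) <= (C * rho * h `^ (b + 1))%:E)%E.
Proof.
have b10 : 0 < b + 1 by rewrite -ltrBlDr sub0r.
have [C C0 CU] := weighted_area_dyadic_le b1.
(* The ratio of consecutive shell bounds. It is below 1 because [b + 1 > 0], which gives the factor
   [1 / (1 - q)] of the geometric series. *)
pose q : R := 2^-1 `^ (b + 1).
have q0 : 0 <= q by exact: powR_ge0.
have q1 : q < 1.
  have : 2^-1 `^ (b + 1) < (1 : R) `^ (b + 1).
    by apply: gt0_ltr_powR; rewrite ?nnegrE// ?invf_lt1 ?ltr1n.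
  by rewrite powR1.
exists (C / (1 - q)); first by rewrite divr_ge0// subr_ge0 ltW.
move=> z0 rho h r0 h0; have [m mE] := weighted_area_measureP b1.
rewrite mE in CU *.
apply: le_trans.
  apply: measure_sigma_subadditive (@carleson_box_dyadic z0 rho h).
    by move=> k; exact: measurable_annulus_box.
  exact: measurable_carleson_box.
apply: lime_le; first exact: is_cvg_nneseries.
apply: nearW => n.
apply: (@le_trans _ _ (\sum_(0 <= k < n) (C * rho * (h `^ (b + 1) * q ^+ k))%:E)%E).
  apply: lee_sum => k _.
  apply: le_trans (CU z0 rho (h / 2 ^+ k) r0 _) _; first by rewrite divr_gt0 ?exprn_gt0.
  have -> : (h / 2 ^+ k) `^ (b + 1) = h `^ (b + 1) * q ^+ k.
    rewrite powRM ?(ltW h0) ?invr_ge0 ?exprn_ge0//; congr (_ * _).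
    rewrite -exprVn -powR_mulrn ?invr_ge0// -powRrM mulrC.
    by rewrite powRrM -/q powR_mulrn.
  exact: lexx.
rewrite sumEFin lee_fin big_mkord -mulr_sumr -mulr_sumr.
rewrite (_ : C / (1 - q) * rho * h `^ (b + 1) =
  C * rho * (h `^ (b + 1) * (1 - q)^-1)); last by ring.
rewrite ler_wpM2l ?mulr_ge0// ler_wpM2l ?powR_ge0//.
have q11 : 0 < 1 - q by rewrite subr_gt0.
rewrite -[leRHS]mul1r ler_pdivlMr// mulrC -opprB mulNr -subrX1 opprB.
by rewrite gerBl exprn_ge0.
Qed.

End carleson.

(** * Distance to the nearest root of a complex number *)

Section nearest_root.

(** For [P] the monic polynomial with root list [s], this is [|P' / P| <= \sum 1 / |z - r| <= size s
    / m] cleared of denominators, so that it also makes sense at a root. Leibniz's rule drives the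
    induction. *)
Lemma horner_deriv_prod_le (F : numDomainType) (s : seq F) (z m : F) : 0 <= m ->
  {in s, forall r, m <= `|z - r|} ->
  m * `|(\prod_(r <- s) ('X - r%:P))^`().[z]| <=
  (size s)%:R * `|(\prod_(r <- s) ('X - r%:P)).[z]|.
Proof.
move=> m0; elim: s => [|r s IH] ms.
  by rewrite big_nil -polyC1 derivC horner0 normr0 mulr0 mul0r.
rewrite big_cons; set Q := \prod_(j <- s) _ in IH *.
rewrite derivM derivXsubC mul1r hornerD !hornerM hornerXsubC normrM.
apply: (@le_trans _ _ (m * (`|Q.[z]| + `|z - r| * `|Q^`().[z]|))).
  by rewrite ler_wpM2l// (le_trans (ler_normD _ _))// normrM.
have mr : m <= `|z - r| by apply: ms; rewrite mem_head.
have {}IH := IH (fun r' r's => ms r' (mem_behead (s := r :: s) r's)).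
rewrite mulrDr mulrCA -[X in X%:R]addn1 natrD mulrDl mul1r addrC lerD//.
  by rewrite [leRHS]mulrCA ler_wpM2l.
by rewrite ler_wpM2r.
Qed.

Lemma seq_norm_min (F : numDomainType) (s : seq F) (z : F) : s != [::] ->
  exists2 r, r \in s & {in s, forall r', `|z - r| <= `|z - r'|}.
Proof.
elim: s => // r s IH _; have [->|s0] := eqVneq s [::].
  by exists r; rewrite ?mem_head// => r'; rewrite inE => /eqP ->.
have [r0 r0s r0m] := IH s0.
have /orP[le|le] : (`|z - r| <= `|z - r0|) || (`|z - r0| <= `|z - r|).
  by apply: real_leVge; rewrite normr_real.
- exists r; rewrite ?mem_head// => r'; rewrite inE => /predU1P[->//|/r0m].
  exact: le_trans.
- exists r0; first by rewrite inE r0s orbT.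
  by move=> r'; rewrite inE => /predU1P[->//|/r0m].
Qed.

(* The nearest root [r] of [P = 'X^p - zeta] satisfies
   [`|z - r| * `|P^`().[z]| <= p * `|P.[z]|], by logarithmic differentiation. *)
Lemma nearest_root (F : numClosedFieldType) (p : nat) (zeta : F) : (0 < p)%N ->
  exists2 s : seq F, size s = p & forall z,
    exists2 r, r \in s & `|z - r| * `|z| ^+ p.-1 <= `|z ^+ p - zeta|.
Proof.
move=> p0; have := closed_field_poly_normal ('X^p - zeta%:P).
rewrite lead_coefXnsubC// => -[s]; rewrite scale1r => Ps.
have szs : size s = p.
  by apply: succn_inj; rewrite -(size_prod_XsubC s id) -Ps size_XnsubC.
exists s => // z; have [|r rs rm] := @seq_norm_min _ s z.
  by rewrite -size_eq0 szs -lt0n.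
exists r => //; have := horner_deriv_prod_le (normr_ge0 _) rm.
rewrite -Ps szs derivB derivXn derivC subr0 hornerMn hornerXn normrMn normrX.
rewrite !hornerE mulrnAr -mulr_natl ler_pM2l ?ltr0n//.
Qed.

End nearest_root.

(** * Boundary layers of preimages of discs under powers *)

Section power_box_measurable.
Variable R : realType.

(** Confines the last coordinate of the product (with [p = 1]) and every coordinate of the power
    sum. The centre [zeta] may have any modulus. *)
Definition power_box p (zeta : R[i]) (rho h : R) : set R[i] :=
  [set z | [/\ disc z, nm (z ^+ p - zeta) <= rho & 1 - sqn z <= h]].

Lemma measurable_exprC p :
  measurable_fun [set: R[i]] (fun z : R[i] => complex.Re (z ^+ p)) /\
  measurable_fun [set: R[i]] (fun z : R[i] => complex.Im (z ^+ p)).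
Proof.
have mRe := @measurable_Re R; have mIm := @measurable_Im R.
elim: p => [|p [IH1 IH2]]; first by split; exact: measurable_cst.
have E (z : R[i]) : z ^+ p.+1 =
    (complex.Re z * complex.Re (z ^+ p) - complex.Im z * complex.Im (z ^+ p)) +i*
    (complex.Re z * complex.Im (z ^+ p) + complex.Im z * complex.Re (z ^+ p)).
  by rewrite exprS; case: z => x y; case: (_ ^+ p).
split.
  rewrite (_ : (fun z => _) = fun z : R[i] =>
    complex.Re z * complex.Re (z ^+ p) - complex.Im z * complex.Im (z ^+ p)).
    by apply: measurable_funB; apply: measurable_funM.
  by apply/funext => z; rewrite E.
rewrite (_ : (fun z => _) = fun z : R[i] =>
    complex.Re z * complex.Im (z ^+ p) + complex.Im z * complex.Re (z ^+ p)).
  by apply: measurable_funD; apply: measurable_funM.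
by apply/funext => z; rewrite E.
Qed.

Lemma measurable_power_box p zeta rho h : 0 <= rho ->
  measurable (power_box p zeta rho h).
Proof.
move=> r0; have ms := @measurable_sqn R.
have m1 : measurable_fun setT (fun z : R[i] => 1 - sqn z) by exact: measurable_funB.
have -> : power_box p zeta rho h = @disc R `&`
    [set z | sqn (z ^+ p - zeta) <= rho ^+ 2] `&` [set z | 1 - sqn z <= h].
  apply/seteqP; split => z; first by case=> ? + ?; rewrite normc_le.
  by case=> -[? ? ?]; split => //; rewrite normc_le.
apply: measurableI; last exact: measurable_ler.
apply: measurableI; first exact: measurable_disc.
have [mR mI] := measurable_exprC p.
apply: measurable_ler => //.
have -> : (fun z => sqn (z ^+ p - zeta)) = fun z : R[i] =>
    (complex.Re (z ^+ p) - complex.Re zeta) ^+ 2 +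
    (complex.Im (z ^+ p) - complex.Im zeta) ^+ 2.
  by apply/funext => z; case: (z ^+ p); case: (zeta).
by apply: measurable_funD; apply/measurable_funX/measurable_funB.
Qed.

End power_box_measurable.

Section power_box.
Variables (R : realType) (b : R).
Hypothesis b1 : -1 < b.
Implicit Types (z : R[i]) (A : set R[i]) (rho h : R).

Lemma weighted_area_disc_fin : exists2 M, 0 <= M & (weighted_area b (@disc R) <= M%:E)%E.
Proof.
have [C C0 CU] := weighted_area_carleson_le b1.
(* The disc is contained in the Carleson box with centre 0 and [rho = h = 1]. *)
exists C => //; have := CU 0 1 1 ler01 ltr01; rewrite powR1 !mulr1.
apply: le_trans; apply: le_weighted_area => // z /disc_sqn z1.
have z0 : 0 <= sqn z by rewrite addr_ge0 ?sqr_ge0.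
by split; rewrite ?subr0 ?z1 ?expr1n; lra.
Qed.

Lemma weighted_area_carleson_seq_le : exists2 C, 0 <= C &
  forall (s : seq R[i]) rho h, 0 <= rho -> 0 < h ->
  (weighted_area b [set z | exists2 r, r \in s & carleson_box r rho h z] <=
    ((size s)%:R * (C * rho * h `^ (b + 1)))%:E)%E.
Proof.
have [C C0 CU] := weighted_area_carleson_le b1.
exists C => // s rho h r0 h0; have [m mE] := weighted_area_measureP b1.
rewrite mE in CU *.
pose U (s : seq R[i]) := [set z | exists2 r, r \in s & carleson_box r rho h z].
(* Measurability is carried along with the bound because subadditivity asks for it at each step. *)
suff [_] : measurable (U s) /\ (m (U s) <=
    ((size s)%:R * (C * rho * h `^ (b + 1)))%:E)%E by [].
elim: s => [|r s [mU IH]].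
  have -> : U [::] = set0 by rewrite -subset0 => z [].
  by rewrite measure0 mul0r; split.
have -> : U (r :: s) = carleson_box r rho h `|` U s.
  apply/seteqP; split => z.
    by case=> r'; rewrite inE => /predU1P[->|r's] zr; [left|right; exists r'].
  by case=> [zr|[r' r's zr]]; [exists r|exists r']; rewrite // inE ?eqxx ?r's ?orbT.
have mr := measurable_carleson_box r rho h; split; first exact: measurableU.
apply: le_trans (measureU2 _ mr mU) _.
rewrite -[X in X%:R]add1n natrD mulrDl mul1r EFinD; apply: leeD => //.
exact: CU.
Qed.

(** For [h <= 1/2] the points have modulus at least 1/2, so [nearest_root] puts them within
    [2^(p-1) * rho] of one of [p] roots, and [p] Carleson boxes cover the set. For larger [h], the
    condition [h <= B * rho] keeps [rho] away from 0 and the total mass of the disc is a sufficient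
    bound. *)
Lemma weighted_area_power_le p B : (0 < p)%N -> 0 < B -> exists2 C, 0 <= C &
  forall zeta rho h, 0 <= rho -> 0 < h -> h <= B * rho ->
  (weighted_area b (power_box p zeta rho h) <= (C * rho * h `^ (b + 1))%:E)%E.
Proof.
move=> p0 B0.
have b10 : 0 < b + 1 by rewrite -ltrBlDr sub0r.
have [M M0 MU] := weighted_area_disc_fin.
have [C C0 CU] := weighted_area_carleson_seq_le.
have p20 : 0 <= (2 : R) ^+ p.-1 by rewrite exprn_ge0.
pose C1 := p%:R * C * 2 ^+ p.-1; pose C2 := M * (2 * B) * 2 `^ (b + 1).
have C10 : 0 <= C1 by rewrite /C1 !mulr_ge0.
have C20 : 0 <= C2 by rewrite /C2 !mulr_ge0 ?powR_ge0// ltW.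
exists (C1 + C2); first exact: addr_ge0.
move=> zeta rho h r0 h0 hB.
have ph0 : 0 <= rho * h `^ (b + 1) by rewrite mulr_ge0 ?powR_ge0.
have [h2|h2] := lerP h 2^-1; last first.
  apply: (@le_trans _ _ M%:E).
    by apply: le_trans MU; apply: le_weighted_area => // z [].
  rewrite lee_fin -mulrA mulrDl ler_wpDl//; first exact: mulr_ge0.
  rewrite /C2 (_ : _ * (rho * _) = M * ((2 * B * rho) * (2 `^ (b + 1) * h `^ (b + 1)))).
    2: by ring.
  rewrite ler_peMr// -powRM//; last exact: ltW.
  have h12 : 1 <= 2 * h by lra.
  apply: mulr_ege1; first by nra.
  have := @ge0_ler_powR _ (b + 1) (ltW b10) 1 (2 * h).
  by rewrite powR1; apply => //; rewrite nnegrE; lra.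
have [s ss sP] := nearest_root zeta p0.
have r20 : 0 <= 2 ^+ p.-1 * rho by rewrite mulr_ge0.
apply: (@le_trans _ _ ((size s)%:R * (C * (2 ^+ p.-1 * rho) * h `^ (b + 1)))%:E); last first.
  rewrite lee_fin ss -subr_ge0 (_ : _ - _ = C2 * (rho * h `^ (b + 1))).
    exact: mulr_ge0.
  by rewrite /C1; ring.
apply: le_trans (CU s _ _ r20 h0); apply: le_weighted_area => // z [zD zr zh].
have [r rs] := sP z; rewrite !normr_normc -rmorphXn/= -rmorphM/= lecR => rz.
exists r => //; have z0 := normc_ge0 z; have zr0 := normc_ge0 (z - r); split.
  rewrite -normc_le// mulrC.
  have z2 : 2^-1 <= nm z.
    rewrite -(@ler_pXn2r _ 2) ?nnegrE// sqr_normc_sqn; lra.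
  have z2p : 2^-1 ^+ p.-1 <= nm z ^+ p.-1 by rewrite lerXn2r ?nnegrE.
  rewrite -ler_pdivrMr ?exprn_gt0// -exprVn.
  by apply: le_trans zr; apply: le_trans rz; rewrite ler_wpM2l.
by rewrite zh andbT; apply/disc_sqn.
Qed.

End power_box.

(** * Integration over the first coordinate *)

Section volume.
Variables (R : realType) (b : R).
Hypothesis b1 : -1 < b.

Definition tuple_section n (z : R[i]) (S : set (n.+1.-tuple R[i])) :
  set (n.-tuple R[i]) := [set t : n.-tuple R[i] | S [tuple of z :: t]].

Lemma weighted_volumeS n (S : set (n.+1.-tuple R[i])) :
  weighted_volume b S =
  (\int[weighted_area b]_z weighted_volume b (tuple_section z S))%E.
Proof.
rewrite /= /pushforward /product_measure1; congr (integral _ _ _).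
apply/funext => z /=; congr (weighted_volume b _).
by apply/seteqP; split => t; rewrite /xsection/= inE.
Qed.

Lemma weighted_volume_ge0 n (S : set (n.-tuple R[i])) :
  (0 <= weighted_volume b S)%E.
Proof.
elim: n S => [|n IH] S; first by rewrite /= diracE lee_fin.
rewrite weighted_volumeS; have [m ->] := weighted_area_measureP b1.
exact: integral_ge0.
Qed.

Lemma weighted_volume_set0 n : weighted_volume b (set0 : set (n.-tuple R[i])) = 0%E.
Proof.
elim: n => [|n IH]; first by rewrite /= diracE in_set0.
rewrite weighted_volumeS; have [m ->] := weighted_area_measureP b1.
by apply: integral0_eq => z _; rewrite -IH.
Qed.

Lemma weighted_volume0_le (S : set (0.-tuple R[i])) : (weighted_volume b S <= 1%:E)%E.
Proof. by rewrite /= diracE lee_fin; case: (_ \in _). Qed.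

Lemma weighted_volume0_in (S : set (0.-tuple R[i])) : S [tuple] ->
  weighted_volume b S = 1%:E.
Proof. by move=> S0; rewrite /= diracE mem_set. Qed.

(** Outside [A] the sections of [S] are empty, so the iterated integral only runs over [A]. *)
Lemma weighted_volumeS_le n (S : set (n.+1.-tuple R[i])) (A : set R[i]) (C K : R) :
  measurable A -> 0 <= C -> (weighted_area b A <= K%:E)%E ->
  (forall z, A z -> weighted_volume b (tuple_section z S) <= C%:E)%E ->
  (forall z (t : n.-tuple R[i]), S [tuple of z :: t] -> A z) ->
  (weighted_volume b S <= (C * K)%:E)%E.
Proof.
move=> mA C0 AK SC SA; rewrite weighted_volumeS.
have SA0 z : ~ A z -> weighted_volume b (tuple_section z S) = 0%E.
  move=> Az; rewrite (_ : tuple_section z S = set0) ?weighted_volume_set0//.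
  by rewrite -subset0 => t /SA.
have [m mE] := weighted_area_measureP b1; rewrite mE in AK *.
rewrite EFinM; apply: le_trans (_ : (C%:E * m A <= _)%E); last first.
  by apply: lee_wpmul2l; rewrite ?lee_fin.
apply: integral_le_cst => // z _.
- exact: weighted_volume_ge0.
- have [/SC//|/SA0 ->] := pselect (A z); by rewrite lee_fin.
- exact: SA0.
Qed.

Lemma weighted_volumeS_ge n (S : set (n.+1.-tuple R[i])) (A : set R[i]) (c K : R) :
  measurable A -> 0 <= c -> (K%:E <= weighted_area b A)%E ->
  (forall z, A z -> c%:E <= weighted_volume b (tuple_section z S))%E ->
  ((c * K)%:E <= weighted_volume b S)%E.
Proof.
move=> mA c0 AK Sc; rewrite weighted_volumeS.
have [m mE] := weighted_area_measureP b1; rewrite mE in AK *.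
rewrite EFinM; apply: (@le_trans _ _ (c%:E * m A)%E).
  by apply: lee_wpmul2l; rewrite ?lee_fin.
apply: integral_ge_cst => // z _.
exact: weighted_volume_ge0.
Qed.

End volume.

Section polydisc.
Variable R : realType.
Lemma polydisc_cons n (w : R[i]) (t : n.-tuple R[i]) :
  polydisc [tuple of w :: t] <-> disc w /\ polydisc t.
Proof.
split=> [H|[dw dt] j].
  split; first by have := H ord0; rewrite (tnth_nth 0).
  by move=> j; have := H (lift ord0 j); rewrite !(tnth_nth 0).
case: (unliftP ord0 j) => [k|] ->; rewrite (tnth_nth 0)//=.
by have := dt k; rewrite (tnth_nth 0).
Qed.

Lemma coord_prod_cons n (w : R[i]) (t : n.-tuple R[i]) :
  coord_prod [tuple of w :: t] = w * coord_prod t.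
Proof.
rewrite /coord_prod big_ord_recl (tnth_nth 0)/=; congr (_ * _).
by apply: eq_bigr => j _; rewrite !(tnth_nth 0).
Qed.

Lemma coord_prod_nil : coord_prod ([tuple] : 0.-tuple R[i]) = 1.
Proof. by rewrite /coord_prod big_ord0. Qed.

Lemma polydisc_nil : polydisc ([tuple] : 0.-tuple R[i]).
Proof. by case. Qed.

Lemma normc_coord_prod_le1 n (t : n.-tuple R[i]) : polydisc t -> nm (coord_prod t) <= 1.
Proof.
move=> pt; rewrite -lecR -normr_normc normr_prod; apply: prodr_ile1 => j _.
by rewrite normr_ge0/= ltW//; exact: pt.
Qed.

End polydisc.

(** * The product of the coordinates *)

Section product.
Variables (R : realType) (b : R) (eta : R[i]).
Hypothesis b1 : -1 < b.
Hypothesis eta1 : nm eta = 1.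

(** The factor [c] collects the product of the coordinates already fixed, which makes the induction
    on [n] close; the theorem is the case [c = 1]. *)
Definition prod_near n (c : R[i]) (d : R) : set (n.-tuple R[i]) :=
  [set z | polydisc z /\ nm (c * coord_prod z - eta) <= d].

Lemma prod_near_cons n c d w (t : n.-tuple R[i]) :
  prod_near c d [tuple of w :: t] <-> disc w /\ prod_near (c * w) d t.
Proof.
rewrite /prod_near/= coord_prod_cons mulrA; split.
  by case=> /polydisc_cons[? ?] ?.
by case=> ? [? ?]; split => //; apply/polydisc_cons.
Qed.

(** The remaining product has modulus at most 1, so [1 = |eta| <= |c| + d]. *)
Lemma prod_near_normc n c d (t : n.-tuple R[i]) : nm c <= 1 ->
  prod_near c d t -> 1 - d <= nm c.
Proof.
move=> c1 [pt cd]; have := normcD (c * coord_prod t) (eta - c * coord_prod t).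
rewrite subrKC eta1 normcB normcM.
have := normc_coord_prod_le1 pt; have := normc_ge0 c.
have := normc_ge0 (coord_prod t).
nra.
Qed.

Lemma prod_near_le n : exists2 C, 0 <= C & forall c d, nm c <= 1 -> 0 < d < 1 ->
  (weighted_volume b (prod_near (n := n.+1) c d) <=
   (C * ((d `^ (b + 1)) ^+ n.+1 * d))%:E)%E.
Proof.
have b10 : 0 < b + 1 by rewrite -ltrBlDr sub0r.
have t2 (d : R) : 0 < d -> (2 * d) `^ (b + 1) = 2 `^ (b + 1) * d `^ (b + 1).
  by move=> d0; rewrite powRM// ltW.
have q0 : 0 <= (2 : R) `^ (b + 1) by exact: powR_ge0.
elim: n => [|n [C C0 IH]].
  have [M M0 MU] := weighted_area_disc_fin b1.
  have [C C0 CU] := @weighted_area_power_le _ _ b1 1 1 isT ltr01.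
  exists ((C + M) * (2 * 2 `^ (b + 1))); first by rewrite !mulr_ge0// addr_ge0.
  move=> c d c1 /andP[d0 d1].
  rewrite [X in X%:E](_ : _ = 1 * ((C + M) * (2 * d) * (2 * d) `^ (b + 1))); last first.
    by rewrite t2//; ring.
  have K0 : 0 <= 2 * d * (2 * d) `^ (b + 1) by rewrite !mulr_ge0 ?powR_ge0// ltW.
  (* For [d < 1/2], the bound [1 - d <= |c * z|] forces [|c| >= 1/2], and dividing by [c] places [z]
     within [2 * d] of [eta / c]. Otherwise [2 * d >= 1] and the mass of the whole disc is of the
     right order. *)
  have [d2|d2] := ltrP d 2^-1.
    apply: (@weighted_volumeS_le _ _ b1 _ _ (power_box 1 (eta / c) (2 * d) (2 * d))).
    - by apply: measurable_power_box; lra.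
    - by [].
    - apply: le_trans (CU _ (2 * d) (2 * d) _ _ _) _; [lra|lra|lra|].
      rewrite lee_fin -!mulrA ler_wpM2r//.
        by rewrite mulrA.
      by rewrite lerDl.
    - by move=> *; exact: weighted_volume0_le.
    - move=> z t /prod_near_cons[zD zt].
      have z1 : nm z < 1 by apply/disc_normc.
      have zp := normc_ge0 z; have cp := normc_ge0 c.
      have cz1 : nm (c * z) <= 1 by rewrite normcM; nra.
      have := prod_near_normc cz1 zt; rewrite normcM => cz.
      have c2 : 2^-1 <= nm c by nra.
      have c0 : c != 0 by rewrite -normc_eq0 gt_eqF//; lra.
      split => //; last by apply: sqn_le_normc; nra.
      case: zt => _; rewrite (tuple0 t) coord_prod_nil mulr1 expr1 => zc.
      have : nm (c * (z - eta / c)) <= d by rewrite mulrBr mulrCA divff// mulr1.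
      rewrite normcM; have := normc_ge0 (z - eta / c); nra.
  apply: (@weighted_volumeS_le _ _ b1 _ _ (@disc R)) => //.
  - exact: measurable_disc.
  - apply: le_trans MU _; rewrite lee_fin -mulrA mulrDl.
    rewrite ler_wpDl ?(mulr_ge0 C0 K0)//; rewrite ler_peMr//.
    have d12 : 1 <= 2 * d by lra.
    apply: mulr_ege1 => //.
    have := @ge0_ler_powR _ (b + 1) (ltW b10) 1 (2 * d).
    by rewrite powR1; apply => //; rewrite nnegrE; lra.
  - by move=> *; exact: weighted_volume0_le.
  - by move=> z t /prod_near_cons[].
have [C1 C10 CU] := weighted_area_carleson_le b1.
exists (C * (C1 * 2 `^ (b + 1))); first by rewrite !mulr_ge0.
move=> c d c1 /andP[d0 d1].
rewrite [X in X%:E](_ : _ = (C * ((d `^ (b + 1)) ^+ n.+1 * d)) * (C1 * 1 * (2 * d) `^ (b + 1))).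
  2: by rewrite t2// (exprS _ n.+1); ring.
(* A coordinate other than the last is only forced near the circle: [rho = 1] around 0 imposes
   nothing on a point of the disc. *)
apply: (@weighted_volumeS_le _ _ b1 _ _ (carleson_box 0 1 (2 * d))).
- exact: measurable_carleson_box.
- by rewrite !mulr_ge0 ?exprn_ge0 ?powR_ge0// ltW.
- by apply: CU; lra.
- move=> z [_ /andP[/disc_sqn zD _]].
  have z1 : nm z < 1 by apply/disc_normc.
  have zp := normc_ge0 z; have cp := normc_ge0 c.
  rewrite (_ : tuple_section z _ = prod_near (c * z) d).
    by apply: IH; rewrite ?d0// normcM; nra.
  by apply/seteqP; split => t /=; [case/prod_near_cons|move=> H; exact/prod_near_cons].
- move=> z t /prod_near_cons[zD zt].
  have z1 : nm z < 1 by apply/disc_normc.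
  have zp := normc_ge0 z; have cp := normc_ge0 c.
  have cz1 : nm (c * z) <= 1 by rewrite normcM; nra.
  have := prod_near_normc cz1 zt; rewrite normcM => cz.
  split; first by rewrite subr0 -sqr_normc_sqn; nra.
  apply/andP; split; first exact/disc_sqn.
  by apply: sqn_le_normc; nra.
Qed.

(** The quantity [e * d] is the loss of modulus that the fixed coordinates may have caused. Each
    induction step allows [c] only half of it and leaves the rest to the new coordinate, which
    spends at most [e * d / 8]. *)
Lemma prod_near_ge n : exists c0 e : R, [/\ 0 < c0, 0 < e, e <= 1 &
  forall c d, nm c <= 1 -> 1 - nm c <= e * d -> 0 < d < 1 ->
  ((c0 * ((d `^ (b + 1)) ^+ n.+1 * d))%:E <=
   weighted_volume b (prod_near (n := n.+1) c d))%E].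
Proof.
have [c1 c10 CU] := weighted_area_ge b1.
elim: n => [|n [c0 [e [c00 e0 e1 IH]]]].
  exists (c1 * 2^-1 * 16^-1 `^ (b + 1)), 2^-1; split.
  - by rewrite !mulr_gt0 ?powR_gt0.
  - by [].
  - by lra.
  move=> c d cle cd /andP[d0 d1].
  have c0 : c != 0 by rewrite -normc_eq0 gt_eqF//; lra.
  rewrite [X in X%:E](_ : _ = 1 * (c1 * (d / 2) * (16^-1 * d) `^ (b + 1))); last first.
    by rewrite powRM ?(ltW d0)//; ring.
  (* The unimodular point with [c * u = |c| * eta]. Then [|c * z - eta| <= |c| * |z - u| + (1 -
     |c|)], and each summand is at most [d / 2]. *)
  pose u := eta / (c / (nm c)%:C).
  have nc0 : nm c != 0 by rewrite normc_eq0.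
  have ncC : nm (nm c)%:C = nm c.
    by rewrite /= expr0n addr0 sqrtr_sqr ger0_norm// normc_ge0.
  have cu : c * u = eta * (nm c)%:C.
    by rewrite /u invf_div mulrCA; congr (_ * _); rewrite mulrC divfK.
  have u1 : sqn u = 1.
    by rewrite -sqr_normc_sqn /u !normcM normcV normcM normcV ncC eta1 divff// invr1 mulr1 expr1n.
  apply: (@weighted_volumeS_ge _ _ b1 _ _
      (annulus_box u (d / 2) (16^-1 * d / 2) (16^-1 * d))).
  - exact: measurable_annulus_box.
  - by [].
  - by apply: CU => //; lra.
  - move=> z [zu zh]; rewrite weighted_volume0_in//.
    have zu2 : nm (z - u) <= d / 2 by rewrite normc_le//; lra.
    apply/prod_near_cons; split; first by apply/disc_sqn; lra.
    split; first exact: polydisc_nil.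
    rewrite coord_prod_nil mulr1.
    have -> : c * z - eta = c * (z - u) + (c * u - eta) by ring.
    apply: le_trans (normcD _ _) _; rewrite normcM.
    have -> : nm (c * u - eta) = 1 - nm c.
      rewrite cu -[X in _ - X]mulr1 -mulrBr normcM eta1 mul1r normcB.
      rewrite (_ : 1 - _ = (1 - nm c)%:C); last by rewrite rmorphB.
      by rewrite /= expr0n addr0 sqrtr_sqr ger0_norm// subr_ge0.
    have := normc_ge0 c; have := normc_ge0 (z - u); nra.
exists (c0 * (c1 * (e / 8) `^ (b + 1))), (e / 2); split.
- by rewrite !mulr_gt0 ?powR_gt0//; lra.
- by lra.
- by lra.
move=> c d cle cd /andP[d0 d1].
rewrite [X in X%:E](_ : _ = (c0 * ((d `^ (b + 1)) ^+ n.+1 * d)) *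
    (c1 * 1 * (e / 8 * d) `^ (b + 1))).
  2: by rewrite (@powRM _ (e / 8) d) ?(ltW d0) 1?(exprS _ n.+1)//; [ring|lra].
have ed0 : 0 < e / 8 * d by rewrite mulr_gt0//; lra.
have ed1 : e / 8 * d <= 1 / 8 by nra.
(* Only the modulus of this coordinate matters: any unimodular centre would do in place of 1, and
   the radius is the largest one that [weighted_area_ge] covers. *)
apply: (@weighted_volumeS_ge _ _ b1 _ _
      (annulus_box 1 1 (e / 8 * d / 2) (e / 8 * d))).
- exact: measurable_annulus_box.
- by rewrite !mulr_ge0 ?exprn_ge0 ?powR_ge0// ltW.
- by apply: CU => //; rewrite /sqn/= expr0n addr0 expr1n.
- move=> z [_ /andP[z1 z2]].
  have zD : disc z by apply/disc_sqn; lra.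
  have z3 : nm z < 1 by apply/disc_normc.
  have z4 := normc_ge_sqn (ltW ed0) z2.
  have zp := normc_ge0 z; have cp := normc_ge0 c.
  rewrite (_ : tuple_section z _ = prod_near (c * z) d).
    by apply: IH; rewrite ?d0// normcM; nra.
  by apply/seteqP; split => t /=; [case/prod_near_cons|move=> H; exact/prod_near_cons].
Qed.

End product.

(** * Lipschitz bound for powers; components along and across a direction *)

Lemma normXB_le (F : numDomainType) (x y : F) n : `|x| <= 1 -> `|y| <= 1 ->
  `|x ^+ n - y ^+ n| <= n%:R * `|x - y|.
Proof.
move=> x1 y1; elim: n => [|n IH]; first by rewrite !expr0 subrr normr0 mul0r.
have -> : x ^+ n.+1 - y ^+ n.+1 = x * (x ^+ n - y ^+ n) + (x - y) * y ^+ n.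
  by rewrite !exprS; ring.
rewrite -natr1 [leRHS]mulrDl mul1r (le_trans (ler_normD _ _))//.
rewrite !normrM normrX lerD//.
  by apply: le_trans IH; rewrite ler_piMl.
by rewrite ler_piMr// exprn_ile1.
Qed.

Section dot_cross.
Variable R : realType.
Implicit Types u v w z : R[i].

(** With [ccross], the real and imaginary parts of [v] times the conjugate of [u]; for unimodular
    [u], the components of [v] along and across [u]. *)
Definition cdot u v : R :=
  complex.Re u * complex.Re v + complex.Im u * complex.Im v.

Definition ccross u v : R :=
  complex.Re u * complex.Im v - complex.Im u * complex.Re v.

Lemma cdotDr u v w : cdot u (v + w) = cdot u v + cdot u w.
Proof. by case: u v w => ? ? [? ?] [? ?]; rewrite /cdot/=; ring. Qed.

Lemma cdotBr u v w : cdot u (v - w) = cdot u v - cdot u w.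
Proof. by case: u v w => ? ? [? ?] [? ?]; rewrite /cdot/=; ring. Qed.

Lemma ccrossDr u v w : ccross u (v + w) = ccross u v + ccross u w.
Proof. by case: u v w => ? ? [? ?] [? ?]; rewrite /ccross/=; ring. Qed.

Lemma ccrossBr u v w : ccross u (v - w) = ccross u v - ccross u w.
Proof. by case: u v w => ? ? [? ?] [? ?]; rewrite /ccross/=; ring. Qed.

Lemma cdot_self u : cdot u u = nm u ^+ 2.
Proof. by rewrite sqr_normc_sqn /cdot /sqn; ring. Qed.

Lemma ccrossZ_self u (k : R) : ccross u (u * k%:C) = 0.
Proof. by case: u => ? ?; rewrite /ccross/=; ring. Qed.

(** Lagrange's identity. *)
Lemma cdot_cross u v : cdot u v ^+ 2 + ccross u v ^+ 2 = (nm u * nm v) ^+ 2.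
Proof. by rewrite exprMn !sqr_normc_sqn /cdot /ccross /sqn; ring. Qed.

Lemma cdot_norm_le u v : `|cdot u v| <= nm u * nm v.
Proof.
apply: (@sqr_ler_norm _ _ (ccross u v)); last by rewrite cdot_cross.
by rewrite mulr_ge0 ?normc_ge0.
Qed.

Lemma ccross_norm_le u v : `|ccross u v| <= nm u * nm v.
Proof.
apply: (@sqr_ler_norm _ _ (cdot u v)); last by rewrite addrC cdot_cross.
by rewrite mulr_ge0 ?normc_ge0.
Qed.

Lemma normcB_sqr u v : nm (u - v) ^+ 2 = nm u ^+ 2 - 2 * cdot v u + nm v ^+ 2.
Proof. by rewrite !sqr_normc_sqn /cdot /sqn; case: u v => ? ? [? ?]/=; ring. Qed.

Lemma normc_real (k : R) : 0 <= k -> nm k%:C = k.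
Proof. by move=> k0; rewrite /= expr0n addr0 sqrtr_sqr ger0_norm. Qed.

Lemma normcXB_le u v n : nm u <= 1 -> nm v <= 1 ->
  nm (u ^+ n - v ^+ n) <= n%:R * nm (u - v).
Proof.
move=> u1 v1; have := @normXB_le _ u v n.
rewrite !normr_normc !lecR => /(_ u1 v1).
by rewrite -[n%:R in X in X -> _](rmorph_nat (real_complex R)) -rmorphM lecR.
Qed.

Lemma unimodular_root u p : (0 < p)%N -> nm u = 1 ->
  exists2 v, v ^+ p = u & nm v = 1.
Proof.
move=> p0 u1; exists (p.-root u); first exact: rootCK.
apply/eqP; rewrite -(pexpr_eq1 (n := p)) ?normc_ge0//.
by rewrite -normcX rootCK// u1.
Qed.

End dot_cross.

(** * The power sum *)

Section powsum.
Variables (R : realType) (b : R) (eta : R[i]) (p : nat).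
Hypothesis b1 : -1 < b.
Hypothesis eta1 : nm eta = 1.
Hypothesis p0 : (0 < p)%N.

(** The exponent [p] is separate from the number of variables, because the induction removes
    coordinates while the exponent stays fixed. *)
Definition powsum n (a : 'I_n -> R[i]) (z : n.-tuple R[i]) : R[i] :=
  \sum_(j < n) a j * tnth z j ^+ p.

(** The shift [c] is the contribution of the coordinates already fixed. *)
Definition powsum_near n (a : 'I_n -> R[i]) (c : R[i]) (d : R) :
  set (n.-tuple R[i]) :=
  [set z | polydisc z /\ nm (powsum a z + c - eta) <= d].

Lemma powsum_cons n (a : 'I_n.+1 -> R[i]) w (t : n.-tuple R[i]) :
  powsum a [tuple of w :: t] =
  a ord0 * w ^+ p + powsum (fun j => a (lift ord0 j)) t.
Proof.
rewrite /powsum big_ord_recl (tnth_nth 0)/=; congr (_ + _).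
by apply: eq_bigr => j _; rewrite !(tnth_nth 0).
Qed.

Lemma normc_powsum_le n (a : 'I_n -> R[i]) (t : n.-tuple R[i]) :
  polydisc t -> nm (powsum a t) <= \sum_(j < n) nm (a j).
Proof.
move=> pt; rewrite -lecR -normr_normc rmorph_sum/=.
apply: le_trans (ler_norm_sum _ _ _) _; apply: ler_sum => j _.
rewrite normrM normrX normr_normc ler_piMr// -?normr_normc//.
by rewrite exprn_ile1// ltW//; exact: pt.
Qed.

Lemma powsum_near_cons n (a : 'I_n.+1 -> R[i]) c d w (t : n.-tuple R[i]) :
  powsum_near a c d [tuple of w :: t] <->
  disc w /\ powsum_near (fun j => a (lift ord0 j)) (c + a ord0 * w ^+ p) d t.
Proof.
rewrite /powsum_near/= powsum_cons.
have -> : a ord0 * w ^+ p + powsum (fun j => a (lift ord0 j)) t + c - eta =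
  powsum (fun j => a (lift ord0 j)) t + (c + a ord0 * w ^+ p) - eta by ring.
split; first by case=> /polydisc_cons[? ?] ?.
by case=> ? [? ?]; split => //; apply/polydisc_cons.
Qed.

(* The other coordinates contribute at most [1 - nm (a ord0)] to the projection
   on [eta], so the first one has to be nearly aligned with [eta]. *)
Lemma powsum_near_first n (a : 'I_n.+1 -> R[i]) c d w (t : n.-tuple R[i]) :
  0 < nm (a ord0) -> 0 < d -> \sum_j nm (a j) + nm c <= 1 ->
  powsum_near a c d [tuple of w :: t] ->
  nm (w ^+ p - eta * (nm (a ord0))%:C / a ord0) ^+ 2 <= 2 * d / nm (a ord0) /\
  1 - sqn w <= 2 * (d / nm (a ord0)).
Proof.
move=> a0 d0; rewrite big_ord_recl => ac /powsum_near_cons[wD [pt Hd]].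
set y := powsum _ t in Hd; set x := a ord0 * w ^+ p in Hd.
set al := nm (a ord0) in a0 ac *.
have ny : nm (y + c) <= 1 - al.
  by have := normc_powsum_le (fun j => a (lift ord0 j)) pt; have := normcD y c; rewrite -/y; lra.
have w1 : nm w <= 1 by apply/ltW/disc_normc.
have wp0 := normc_ge0 w.
have nx : nm x = al * nm w ^+ p by rewrite /x normcM normcX.
have wpw : nm w ^+ p <= nm w by rewrite ler_iXnr// wp0.
have xal : nm x <= al by rewrite nx ler_piMr ?(ltW a0)// exprn_ile1.
have xdot : al - d <= cdot eta x.
  have -> : x = (y + (c + x) - eta) + eta - (y + c) by ring.
  rewrite cdotBr cdotDr cdot_self eta1 expr1n.
  have := cdot_norm_le eta (y + (c + x) - eta); have := cdot_norm_le eta (y + c).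
  by rewrite eta1 !mul1r !ler_norml => /andP[? ?] /andP[? ?]; lra.
(* Expanding the square with [|x| <= al] and [cdot eta x >= al - d] leaves [2 * d * al]: an error
   [d] along [eta] becomes an error of order [sqrt d] in position. *)
have x2 : nm (x - eta * al%:C) ^+ 2 <= 2 * d * al.
  rewrite normcB_sqr (normcM eta al%:C) (normc_real (ltW a0)) eta1 mul1r.
  have -> : cdot (eta * al%:C) x = al * cdot eta x.
    by case: (x) (eta) => ? ? [? ?]; rewrite /cdot/=; ring.
  by have := normc_ge0 x; nra.
have a00 : a ord0 != 0 by rewrite -normc_eq0 gt_eqF.
split.
  have E : x - eta * al%:C = a ord0 * (w ^+ p - eta * al%:C / a ord0).
    by rewrite mulrBr [_ / _]mulrC mulVKf.
  move: x2; rewrite E normcM exprMn -/al => x2.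
  by rewrite ler_pdivlMr// -(ler_pM2l a0); lra.
apply: sqn_le_normc; first by rewrite divr_ge0// ltW.
have x3 : al - d <= nm x.
  by apply: le_trans xdot _; have := cdot_norm_le eta x; rewrite eta1 mul1r ler_norml => /andP[].
rewrite -(ler_pM2l a0) mulrBr mulr1 mulrCA divff ?gt_eqF// mulr1.
by apply: le_trans x3 _; rewrite nx ler_pM2l.
Qed.

Lemma powsum_near_le n (a : 'I_n.+1 -> R[i]) : (forall j, 0 < nm (a j)) ->
  exists2 C, 0 <= C & forall c d, \sum_j nm (a j) + nm c <= 1 -> 0 < d < 1 ->
  (weighted_volume b (powsum_near a c d) <=
   (C * ((d `^ (b + 1)) ^+ n.+1 * Num.sqrt d ^+ n * d))%:E)%E.
Proof.
elim: n a => [|n IH] a a0.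
  set al := nm (a ord0).
  have al0 : 0 < al by exact: a0.
  have [C C0 CU] := @weighted_area_power_le _ _ b1 p 2 p0 (ltr0Sn _ 1).
  exists (C * al^-1 * (2 / al) `^ (b + 1)).
    by rewrite !mulr_ge0 ?powR_ge0// invr_ge0 ltW.
  move=> c d ac /andP[d0 d1].
  rewrite [X in X%:E](_ : _ = 1 * (C * (d / al) * (2 / al * d) `^ (b + 1))); last first.
    rewrite (@powRM _ (2 / al) d) ?(ltW d0)//; first by ring.
    by rewrite divr_ge0// ltW.
  have da0 : 0 < d / al by rewrite divr_gt0.
  have E : 2 / al * d = 2 * (d / al) by ring.
  have a00 : a ord0 != 0 by rewrite -normc_eq0 gt_eqF.
  (* With no further coordinate to absorb an error, the defining inequality itself puts [z ^+ p]
     within [d / al] of [(eta - c) / a ord0]. The layer has height twice that radius, whence the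
     constant 2 given to [weighted_area_power_le]. *)
  apply: (@weighted_volumeS_le _ _ b1 _ _
      (power_box p ((eta - c) / a ord0) (d / al) (2 / al * d))).
  - by apply: measurable_power_box; exact: ltW.
  - by [].
  - by apply: CU; rewrite ?E//; lra.
  - by move=> *; exact: weighted_volume0_le.
  - move=> z t zt; have [_ z2] := powsum_near_first al0 d0 ac zt.
    move: zt => /powsum_near_cons[zD [_]]; rewrite /powsum big_ord0 add0r => zc.
    split => //; last by rewrite E.
    rewrite ler_pdivlMr// -normcM.
    have -> : (z ^+ p - (eta - c) / a ord0) * a ord0 = c + a ord0 * z ^+ p - eta.
      by rewrite mulrBl divfK//; ring.
    by [].
set al := nm (a ord0).
have al0 : 0 < al by exact: a0.
have a00 : a ord0 != 0 by rewrite -normc_eq0 gt_eqF.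
(* Below, [rho] is [sqrt (2 / al) * sqrt d] and [h = rho ^+ 2]; since [sqrt d <= 1], this gives
   [h <= B * rho] with [B = sqrt (2 / al)]. *)
have B0 : 0 < Num.sqrt (2 / al) by rewrite sqrtr_gt0 divr_gt0.
have [C C0 CU] := @weighted_area_power_le _ _ b1 p _ p0 B0.
have [C' C'0 {}IH] := IH (fun j => a (lift ord0 j)) (fun j => a0 _).
exists (C' * (C * Num.sqrt (2 / al) * (2 / al) `^ (b + 1))).
  by rewrite !mulr_ge0 ?powR_ge0// sqrtr_ge0.
move=> c d ac /andP[d0 d1].
have al20 : 0 <= 2 / al by rewrite divr_ge0// ltW.
have e0 : 0 < 2 / al * d by rewrite mulr_gt0// divr_gt0.
have se : Num.sqrt (2 / al * d) = Num.sqrt (2 / al) * Num.sqrt d by rewrite sqrtrM.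
rewrite [X in X%:E](_ : _ = (C' * ((d `^ (b + 1)) ^+ n.+1 * Num.sqrt d ^+ n * d)) *
    (C * Num.sqrt (2 / al * d) * (2 / al * d) `^ (b + 1))); last first.
  by rewrite se (@powRM _ (2 / al) d) ?(ltW d0)// (exprS _ n.+1) (exprS (Num.sqrt d) n); ring.
pose zeta := eta * al%:C / a ord0.
apply: (@weighted_volumeS_le _ _ b1 _ _
    (power_box p zeta (Num.sqrt (2 / al * d)) (2 / al * d))).
- by apply: measurable_power_box; exact: sqrtr_ge0.
- by rewrite !mulr_ge0 ?exprn_ge0 ?powR_ge0 ?sqrtr_ge0// ltW.
- apply: CU; rewrite ?sqrtr_ge0// -[leLHS]sqr_sqrtr ?(ltW e0)// {1}se expr2.
  rewrite se -mulrA ler_wpM2l ?sqrtr_ge0// ler_piMl ?mulr_ge0 ?sqrtr_ge0//.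
  by rewrite -sqrtr1 ler_wsqrtr// ltW.
- move=> z [zD _ _].
  rewrite (_ : tuple_section z _ =
      powsum_near (fun j => a (lift ord0 j)) (c + a ord0 * z ^+ p) d).
    apply: IH; rewrite ?d0//; move: ac; rewrite big_ord_recl.
    have := normcD c (a ord0 * z ^+ p); rewrite normcM normcX -/al.
    have z1 : nm z <= 1 by apply/ltW/disc_normc.
    have : al * nm z ^+ p <= al by rewrite ler_piMr ?(ltW al0)// exprn_ile1// normc_ge0.
    by lra.
  by apply/seteqP; split => t /=; [case/powsum_near_cons|move=> H; exact/powsum_near_cons].
- move=> z t zt; have [z1 z2] := powsum_near_first al0 d0 ac zt.
  have E : 2 / al * d = 2 * d / al by ring.
  split; [by case/powsum_near_cons: zt| |by rewrite E -mulrA].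
  by rewrite normc_le ?sqrtr_ge0// sqr_sqrtr ?(ltW e0)// -sqr_normc_sqn E.
Qed.

End powsum.

(** * Lower bound for the power sum *)

Section powsum_lower.
Variables (R : realType) (b : R) (eta : R[i]) (p : nat).
Hypothesis b1 : -1 < b.
Hypothesis eta1 : nm eta = 1.
Hypothesis p0 : (0 < p)%N.

(** The point [alpha * v ^+ p] is the radial projection of the target [e] to the circle of radius
    [|alpha|]. The component of [e] across [eta] enters [|e|] only through its square, so a
    tolerance [k * sqrt d] there still gives [||e| - |alpha|| <= d / 2]; the Lipschitz bound for the
    power supplies the other [d / 2]. *)
Lemma powsum1_near (alpha c z v e : R[i]) (k d : R) :
  0 < nm alpha <= 1 -> e = eta - c -> 0 < d < 1 -> k = nm alpha / 8 ->
  `|cdot eta c - (1 - nm alpha)| <= k * d ->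
  `|ccross eta c| <= k * Num.sqrt d ->
  v ^+ p = e / alpha * (nm alpha / nm e)%:C -> nm v = 1 -> nm z <= 1 ->
  nm (z - v) <= d / (2 * p%:R) ->
  nm (alpha * z ^+ p + c - eta) <= d.
Proof.
set al := nm alpha; move=> /andP[al0 al1] eE /andP[d0 d1] kE.
rewrite !ler_norml => /andP[hc1 hc2] /andP[hs1 hs2] vp v1 z1 zv.
have q0 := sqrtr_ge0 d; have q2 : Num.sqrt d ^+ 2 = d by rewrite sqr_sqrtr// ltW.
have ne2 : nm e ^+ 2 = (1 - cdot eta c) ^+ 2 + ccross eta c ^+ 2.
  have := cdot_cross eta e; rewrite eta1 mul1r => <-.
  rewrite eE cdotBr ccrossBr cdot_self eta1 expr1n.
  have -> : ccross eta eta = 0 by rewrite /ccross; ring.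
  by rewrite sub0r sqrrN.
have ne0 := normc_ge0 e.
have sc : ccross eta c ^+ 2 <= k ^+ 2 * d.
  rewrite -q2 -exprMn -[leLHS]real_normK ?num_real// lerXn2r ?nnegrE//.
    by rewrite mulr_ge0//; lra.
  by rewrite ler_norml hs1.
have kd : k * d <= k by nra.
have ne1 : al - k * d <= nm e.
  have : 0 <= al - k * d by lra.
  by nra.
have ne3 : nm e <= al + d / 2.
  have : nm e ^+ 2 <= (al + k * d) ^+ 2 + k ^+ 2 * d by nra.
  have : (al + k * d) ^+ 2 + k ^+ 2 * d <= (al + d / 2) ^+ 2.
    by rewrite kE; nra.
  move=> h1 h2; have : nm e ^+ 2 <= (al + d / 2) ^+ 2 by exact: le_trans h1.
  by rewrite ler_pXn2r ?nnegrE//; lra.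
have e0 : 0 < nm e by nra.
have a00 : alpha != 0 by rewrite -normc_eq0 gt_eqF.
have -> : alpha * z ^+ p + c - eta = alpha * (z ^+ p - v ^+ p) + (alpha * v ^+ p - e).
  by rewrite eE; ring.
have -> : alpha * v ^+ p - e = e * ((al - nm e) / nm e)%:C.
  rewrite vp mulrA mulrCA divff// mulr1 -[X in _ - X]mulr1 -mulrBr; congr (_ * _).
  by rewrite mulrBl divff ?gt_eqF// rmorphB.
apply: le_trans (normcD _ _) _; rewrite !normcM.
have -> : nm e * nm ((al - nm e) / nm e)%:C = `|al - nm e|.
  rewrite /= expr0n addr0 sqrtr_sqr normrM normfV (ger0_norm ne0) mulrCA.
  by rewrite divff ?gt_eqF// mulr1.
have h1 : `|al - nm e| <= d / 2 by rewrite ler_norml; apply/andP; split; nra.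
have h2 : nm (z ^+ p - v ^+ p) <= d / 2.
  apply: le_trans (normcXB_le p z1 _) _; first by rewrite v1.
  rewrite mulrC -ler_pdivlMr ?ltr0n//; apply: le_trans zv _.
  by rewrite invfM mulrA.
have h3 := normc_ge0 (z ^+ p - v ^+ p).
rewrite -/al; nra.
Qed.

(** Adding one coordinate doubles both tolerances. Across [eta] its error is at most
    [|x - al * eta|], of order [sqrt d]; along [eta] it is [al - cdot eta x], which equals [(|x - al
    * eta|^2 + al^2 - |x|^2) / (2 * al)] and is therefore of order [d]. *)
Lemma powsum_near_step (alpha c z v : R[i]) (s k d : R) :
  0 < nm alpha <= 1 -> 0 < d < 1 -> 0 < k <= 1 ->
  `|cdot eta c - (1 - (nm alpha + s))| <= k / 2 * d ->
  `|ccross eta c| <= k / 2 * Num.sqrt d ->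
  v ^+ p = eta * (nm alpha)%:C / alpha -> nm v = 1 -> nm z <= 1 ->
  nm (z - v) <= k / 2 * Num.sqrt d / p%:R ->
  1 - sqn z <= k / 2 * d / p%:R ->
  `|cdot eta (c + alpha * z ^+ p) - (1 - s)| <= k * d /\
  `|ccross eta (c + alpha * z ^+ p)| <= k * Num.sqrt d.
Proof.
set al := nm alpha; move=> /andP[al0 al1] /andP[d0 d1] /andP[k0 k1].
rewrite cdotDr ccrossDr => hc hs vp v1 z1 zv zs.
set x := alpha * z ^+ p; set q := Num.sqrt d in hs zv *.
have q0 : 0 <= q by exact: sqrtr_ge0.
have q2 : q ^+ 2 = d by rewrite sqr_sqrtr// ltW.
have pp : 0 < (p%:R : R) by rewrite ltr0n.
have a00 : alpha != 0 by rewrite -normc_eq0 gt_eqF.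
have zp0 := normc_ge0 z.
have E : x - eta * al%:C = alpha * (z ^+ p - v ^+ p).
  by rewrite vp /x mulrBr [_ / alpha]mulrC mulVKf.
have dx : nm (x - eta * al%:C) <= al * (k / 2 * q).
  rewrite E normcM -/al ler_wpM2l ?(ltW al0)//.
  apply: le_trans (normcXB_le p z1 _) _; first by rewrite v1.
  by rewrite mulrC -ler_pdivlMr.
have dx0 := normc_ge0 (x - eta * al%:C).
have nx : nm x = al * nm z ^+ p by rewrite /x normcM normcX.
have zp1 : nm z ^+ p <= 1 by rewrite exprn_ile1.
have xal : nm x <= al by rewrite nx ler_piMr ?(ltW al0).
have sx : 1 - (nm z ^+ p) ^+ 2 <= k / 2 * d.
  have s1 : sqn z <= 1 by rewrite -sqr_normc_sqn expr_le1.
  have s0 : 0 <= sqn z by rewrite -sqr_normc_sqn sqr_ge0.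
  rewrite -exprM mulnC exprM sqr_normc_sqn.
  have := @normXB_le _ 1 (sqn z) p; rewrite expr1n normr1 ger0_norm// => /(_ (lexx _) s1).
  have sp1 : 0 <= 1 - sqn z ^+ p by rewrite subr_ge0; exact: exprn_ile1.
  have s2 : 0 <= 1 - sqn z by rewrite subr_ge0.
  rewrite (ger0_norm sp1) (ger0_norm s2) => h.
  by apply: le_trans h _; rewrite mulrC -ler_pdivlMr.
have x2 : 2 * (al * (al - cdot eta x)) = nm (x - eta * al%:C) ^+ 2 + al ^+ 2 - nm x ^+ 2.
  rewrite normcB_sqr (normcM eta al%:C) (normc_real (ltW al0)) eta1 mul1r.
  have -> : cdot (eta * al%:C) x = al * cdot eta x.
    by case: (x) (eta) => ? ? [? ?]; rewrite /cdot/=; ring.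
  by ring.
have dx2 : nm (x - eta * al%:C) ^+ 2 <= al ^+ 2 * (k ^+ 2 / 4 * d).
  apply: (@le_trans _ _ ((al * (k / 2 * q)) ^+ 2)).
    by rewrite ler_pXn2r ?nnegrE// (le_trans dx0).
  by rewrite -q2 le_eqVlt; apply/orP; left; apply/eqP; field.
have x3 : al - cdot eta x <= k / 2 * d.
  have : 2 * (al * (al - cdot eta x)) <= al * (al * (k ^+ 2 / 4 * d + k / 2 * d)).
    by rewrite x2 nx; nra.
  have -> : 2 * (al * (al - cdot eta x)) = al * (2 * (al - cdot eta x)) by ring.
  rewrite ler_pM2l// => h; have kd : 0 < k * d by rewrite mulr_gt0.
  have k2 : 0 <= k ^+ 2 * d <= k * d.
    by rewrite mulr_ge0 ?sqr_ge0 ?(ltW d0)//= ler_pM2r// expr2 ler_piMr// ltW.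
  have al2 : al * (k ^+ 2 / 4 * d + k / 2 * d) <= k ^+ 2 / 4 * d + k / 2 * d.
    by rewrite ler_piMl//; lra.
  by move: k2 => /andP[? ?]; lra.
have x4 : cdot eta x <= al.
  apply: le_trans xal; have := cdot_norm_le eta x; rewrite eta1 mul1r.
  by rewrite ler_norml => /andP[].
have x5 : `|ccross eta x| <= k / 2 * q.
  have -> : ccross eta x = ccross eta (x - eta * al%:C).
    by rewrite ccrossBr ccrossZ_self subr0.
  apply: le_trans (ccross_norm_le _ _) _; rewrite eta1 mul1r.
  by apply: le_trans dx _; rewrite ler_piMl// mulr_ge0//; lra.
move: hc hs x5; rewrite !ler_norml => /andP[? ?] /andP[? ?] /andP[? ?].
by split; apply/andP; split; lra.
Qed.

(** The induction needs room for the accumulated sum [c]: it may deviate from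
    [(1 - \sum_j nm (a j)) * eta] by [k * d] along [eta] and by [k * sqrt d] across. Halving [k] at
    each step matches the loss in [powsum_near_step]. *)
Lemma powsum_near_ge n (a : 'I_n.+1 -> R[i]) : (forall j, 0 < nm (a j)) ->
  \sum_j nm (a j) <= 1 ->
  exists c0 k : R, [/\ 0 < c0, 0 < k, k <= 1 & forall c d, 0 < d < 1 ->
    `|cdot eta c - (1 - \sum_j nm (a j))| <= k * d ->
    `|ccross eta c| <= k * Num.sqrt d ->
  ((c0 * ((d `^ (b + 1)) ^+ n.+1 * Num.sqrt d ^+ n * d))%:E <=
   weighted_volume b (powsum_near eta p a c d))%E].
Proof.
have [c1 c10 CU] := weighted_area_ge b1.
have pp : 0 < (p%:R : R) by rewrite ltr0n.
have p1 : 1 <= (p%:R : R) by rewrite ler1n.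
elim: n a => [|n IH] a a0 a1.
  set al := nm (a ord0).
  have al0 : 0 < al by exact: a0.
  have al1 : al <= 1 by move: a1; rewrite big_ord1.
  have a00 : a ord0 != 0 by rewrite -normc_eq0 gt_eqF.
  exists (c1 * (2 * p%:R)^-1 * (16 * p%:R)^-1 `^ (b + 1)), (al / 8); split.
  - by rewrite !mulr_gt0 ?powR_gt0 ?invr_gt0 ?mulr_gt0.
  - by lra.
  - by lra.
  move=> c d d01; have /andP[d0 d1] := d01; rewrite big_ord1 -/al => hc hs.
  pose e := eta - c.
  have e0 : 0 < nm e.
    rewrite lt_neqAle normc_ge0 andbT eq_sym normc_eq0 subr_eq0; apply/eqP => ec.
    move: hc; rewrite -ec cdot_self eta1 expr1n ler_norml => /andP[_].
    by nra.
  have e00 : e != 0 by rewrite -normc_eq0 gt_eqF.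
  have [v vp v1] : exists2 v, v ^+ p = e / a ord0 * (al / nm e)%:C & nm v = 1.
    apply: unimodular_root => //; rewrite !normcM normcV -/al.
    rewrite normc_real ?divr_ge0 ?(ltW al0) ?(ltW e0)//.
    by field; rewrite !gt_eqF.
  rewrite [X in X%:E](_ : _ = 1 * (c1 * (d / (2 * p%:R)) * ((16 * p%:R)^-1 * d) `^ (b + 1))).
    2: by rewrite powRM ?(ltW d0) ?invr_ge0 ?mulr_ge0//; ring.
  have r1 : d / (2 * p%:R) <= 1 by rewrite ler_pdivrMr ?mulr_gt0//; lra.
  have h0 : 0 < (16 * p%:R)^-1 * d by rewrite mulr_gt0 ?invr_gt0 ?mulr_gt0.
  apply: (@weighted_volumeS_ge _ _ b1 _ _ (annulus_box v (d / (2 * p%:R))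
     ((16 * p%:R)^-1 * d / 2) ((16 * p%:R)^-1 * d))).
  - exact: measurable_annulus_box.
  - by [].
  - apply: CU => //; first by rewrite -sqr_normc_sqn v1 expr1n.
    by rewrite le_eqVlt; apply/orP; left; apply/eqP; field; rewrite gt_eqF.
  - move=> z [zv /andP[zh _]]; rewrite weighted_volume0_in//.
    have zD : disc z by apply/disc_sqn; lra.
    apply/powsum_near_cons; split => //; split; first exact: polydisc_nil.
    rewrite /powsum big_ord0 add0r (addrC c).
    apply: (powsum1_near _ (erefl e) d01 (erefl _) hc hs vp v1) => //.
    + by rewrite al0.
    + by apply/ltW/disc_normc.
    + by rewrite normc_le// divr_ge0 ?(ltW d0)// mulr_ge0// ltW.
set al := nm (a ord0).
have al0 : 0 < al by exact: a0.
have a00 : a ord0 != 0 by rewrite -normc_eq0 gt_eqF.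
move: (a1); rewrite big_ord_recl -/al.
set s := \sum_(i < n.+1) _ => als.
have s0 : 0 <= s by rewrite sumr_ge0// => j _; exact: normc_ge0.
have [|c0 [k [c00 k0 k1 {}IH]]] := IH (fun j => a (lift ord0 j)) (fun j => a0 _).
  by rewrite -/s; lra.
rewrite -/s in IH.
(* Half of the tolerance [k], divided by the Lipschitz constant [p] of the power; the box has radius
   [r * sqrt d] and height [r * d / 8]. *)
pose r := k / 2 / p%:R.
have r0 : 0 < r by rewrite !divr_gt0.
have r80 : 0 < r / 8 by rewrite divr_gt0.
have r1 : r <= 2^-1 by rewrite /r ler_pdivrMr//; nra.
exists (c0 * (c1 * r * (r / 8) `^ (b + 1))), (k / 2); split.
- by rewrite mulr_gt0// mulr_gt0 ?powR_gt0 ?(mulr_gt0 c10 r0).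
- by lra.
- by lra.
move=> c d d01; have /andP[d0 d1] := d01 => hc hs.
set q := Num.sqrt d in hs *.
have q0 : 0 < q by rewrite sqrtr_gt0.
have q2 : q ^+ 2 = d by rewrite sqr_sqrtr// ltW.
have q1 : q < 1 by nra.
have [v vp v1] : exists2 v, v ^+ p = eta * al%:C / a ord0 & nm v = 1.
  apply: unimodular_root => //; rewrite !normcM normcV -/al eta1 mul1r.
  by rewrite normc_real ?(ltW al0)// divff// gt_eqF.
rewrite [X in X%:E](_ : _ = (c0 * ((d `^ (b + 1)) ^+ n.+1 * q ^+ n * d)) *
   (c1 * (r * q) * (r / 8 * d) `^ (b + 1))).
  2: by rewrite (powRM _ (ltW r80) (ltW d0)) (exprS _ n.+1) (exprS q n); ring.
have h0 : 0 < r / 8 * d by rewrite mulr_gt0 ?divr_gt0.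
have rd : r * d <= r * q by rewrite ler_pM2l// -q2; nra.
apply: (@weighted_volumeS_ge _ _ b1 _ _ (annulus_box v (r * q)
     (r / 8 * d / 2) (r / 8 * d))).
- exact: measurable_annulus_box.
- by rewrite !mulr_ge0 ?exprn_ge0 ?powR_ge0// ltW.
- apply: CU => //; first by rewrite -sqr_normc_sqn v1 expr1n.
    by nra.
  by lra.
- move=> z [zv /andP[zh1 zh2]].
  have zD : disc z by apply/disc_sqn; lra.
  have z1 : nm z <= 1 by apply/ltW/disc_normc.
  rewrite (_ : tuple_section z _ =
      powsum_near eta p (fun j => a (lift ord0 j)) (c + a ord0 * z ^+ p) d).
    have rq : r * q = k / 2 * q / p%:R by rewrite /r; ring.
    have rd' : r * d = k / 2 * d / p%:R by rewrite /r; ring.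
    have rd0 : 0 < r * d by rewrite mulr_gt0.
    have [] := @powsum_near_step (a ord0) c z v s k d _ d01 _ hc hs vp v1 z1.
    + by rewrite al0/= -/al; lra.
    + by rewrite k0.
    + by rewrite -rq normc_le// mulr_ge0// ltW.
    + by rewrite -rd'; lra.
    + by move=> ? ?; exact: IH.
  by apply/seteqP; split => t /=; [case/powsum_near_cons|move=> H; exact/powsum_near_cons].
Qed.

End powsum_lower.

(** * Exponents and conclusion *)

Lemma powR_prod_exponent (R : realType) (b d : R) n : 0 < d ->
  d `^ (n%:R * (b + 1) + 1) = (d `^ (b + 1)) ^+ n * d.
Proof.
move=> d0; rewrite [LHS]powRD ?(lt0r_neq0 d0) ?implybT// powRr1 ?(ltW d0)//.
by rewrite (mulrC n%:R) powRrM powR_mulrn ?powR_ge0.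
Qed.

(** For [n.+1] coordinates the extra exponent is [1 + n / 2]: a factor [d] from the last coordinate
    and [sqrt d] from each of the others. *)
Lemma powR_powsum_exponent (R : realType) (b d : R) n : 0 < d ->
  d `^ (n.+1%:R * (b + 1) + (n.+1%:R + 1) / 2) =
  (d `^ (b + 1)) ^+ n.+1 * Num.sqrt d ^+ n * d.
Proof.
move=> d0; have -> : n.+1%:R * (b + 1) + (n.+1%:R + 1) / 2 =
    (n.+1%:R * (b + 1) + 1) + 2^-1 * n%:R by rewrite -[n.+1%:R]natr1; field.
rewrite [LHS]powRD ?(lt0r_neq0 d0) ?implybT// powR_prod_exponent//.
by rewrite powRrM powR12_sqrt ?(ltW d0)// powR_mulrn ?sqrtr_ge0// mulrAC.
Qed.

Lemma comparable01_bounds (R : realType) (F : R -> \bar R) (G : R -> R) (c C : R) :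
  0 < c -> 0 <= C -> (forall d, 0 < d < 1 -> 0 <= G d) ->
  (forall d, 0 < d < 1 -> ((c * G d)%:E <= F d)%E) ->
  (forall d, 0 < d < 1 -> (F d <= (C * G d)%:E)%E) -> comparable01 F G.
Proof.
(* The upper constant may be zero, so it is increased by 1 to become positive. *)
move=> c0 C0 G0 cF CF; exists c, (C + 1); split => //; first by rewrite ltr_wpDl.
move=> d d01; rewrite cF//=; apply: le_trans (CF _ d01) _.
by rewrite lee_fin ler_wpM2r ?lerDl// G0.
Qed.

Theorem proposition5 (R : realType) (n : nat) (hn : (0 < n)%N)
    (alpha : 'I_n -> R[i]) (halpha : \sum_(j < n) `|alpha j| = 1)
    (halpha0 : forall j : 'I_n, alpha j != 0)
    (beta : R) (hbeta : -1 < beta) (eta : R[i]) (heta : `|eta| = 1) :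
  comparable01
    (fun delta : R => weighted_volume beta (n := n)
       [set z | polydisc z /\ `|coord_prod z - eta| <= delta%:C])
    (fun delta : R => delta `^ (n%:R * (beta + 1) + 1)) /\
  comparable01
    (fun delta : R => weighted_volume beta (n := n)
       [set z | polydisc z /\ `|coord_powsum alpha z - eta| <= delta%:C])
    (fun delta : R => delta `^ (n%:R * (beta + 1) + (n%:R + 1) / 2)).
Proof.
case: n hn alpha halpha halpha0 => // n _ a a1 a0.
have eta1 : nm eta = 1 by apply: complexI; rewrite -normr_normc.
have sum1 : \sum_j nm (a j) = 1.
  apply: complexI; rewrite rmorph_sum/= -[RHS]a1.
  by apply: eq_bigr => j _; rewrite normr_normc.
have apos j : 0 < nm (a j) by rewrite lt_neqAle normc_ge0 andbT eq_sym normc_eq0.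
have nm1 : nm (1 : R[i]) = 1 by exact: ComplexField.Normc.normc1.
split.
  have [C C0 CU] := prod_near_le hbeta eta1 n.
  have [c [e [c0 e0 _ cL]]] := prod_near_ge hbeta eta1 n.
  have E (d : R) : [set z : n.+1.-tuple R[i] | polydisc z /\
      `|coord_prod z - eta| <= d%:C] = prod_near eta 1 d.
    by apply/seteqP; split => z [? H]; split => //; move: H;
      rewrite mul1r normr_normc lecR.
  apply: (comparable01_bounds c0 C0) => d /[dup] d01 /andP[d0 _].
  - exact: powR_ge0.
  - rewrite E powR_prod_exponent//; apply: cL; rewrite ?nm1 ?subrr//.
    by rewrite mulr_ge0// ltW.
  - by rewrite E powR_prod_exponent//; apply: CU; rewrite ?nm1.
have sum1' : \sum_j nm (a j) <= 1 by rewrite sum1.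
have [C C0 CU] := powsum_near_le hbeta eta1 (ltn0Sn n) apos.
have [c [k [c0 k0 _ cL]]] := powsum_near_ge hbeta eta1 (ltn0Sn n) apos sum1'.
have E (d : R) : [set z : n.+1.-tuple R[i] | polydisc z /\
    `|coord_powsum a z - eta| <= d%:C] = powsum_near eta n.+1 a 0 d.
  by apply/seteqP; split => z [? H]; split => //; move: H;
    rewrite addr0 normr_normc lecR.
apply: (comparable01_bounds c0 C0) => d /[dup] d01 /andP[d0 _].
- exact: powR_ge0.
(* At [c = 0] with total weight 1, both deviations vanish, so every tolerance [k] admits this
   start. *)
- rewrite E powR_powsum_exponent//; apply: cL => //.
    rewrite sum1 subrr subr0 /cdot/= !mulr0 addr0 normr0.
    by rewrite mulr_ge0// ltW.
  by rewrite /ccross/= !mulr0 subr0 normr0 mulr_ge0 ?sqrtr_ge0// ltW.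
- rewrite E powR_powsum_exponent//; apply: CU => //.
  by rewrite sum1 ComplexField.Normc.normc0 addr0.
Qed.
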